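(* Let $p=p(n)$ be such that $pn \ge n^{2/\sqrt{\log n}}$, and let $G \in G(n,p)$. Then asymptotically almost surely $$t(G) = (1+o(1))\,p\,t(K_n).$$
   Context: $G(n,p)$ is the binomial random graph on $n$ vertices in which each pair of vertices is joined independently with probability $p$. A property holds asymptotically almost surely (a.a.s.) if it holds with probability tending to $1$ as $n\to\infty$. All graphs are finite, simple and undirected. A configuration of a graph $G$ is a function $c: V(G)\to \mathbb{N}\cup\{0\}$. A vertex $v$ may be fired if $c(v)\ge \deg(v)$; firing $v$ removes $\deg(v)$ chips from $v$ and adds one chip to each neighbour of $v$. A configuration is volatile if there is an infinite sequence of vertices that may be fired in that order. The toppling game on $G$: starting with no chips, players Max and Min alternately place one chip on a vertex (Max first); the game ends once a volatile configuration is reached. Max aims to maximize and Min to minimize the number of chips placed. The toppling number $t(G)$ is the length of the game when Max starts and both play optimally. *)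

(* Defs.v *)
From HB Require Import structures.
From mathcomp Require Import all_boot all_order all_algebra.
From mathcomp Require Import all_classical all_reals all_analysis.

Set Implicit Arguments.
Unset Strict Implicit.
Unset Printing Implicit Defensive.

Import Order.TTheory GRing.Theory Num.Theory.
Import numFieldNormedType.Exports.

Local Open Scope nat_scope.

Record sgraph (V : finType) := SGraph {
  edges : {set {set V}};
  edges_card2 : [forall e in edges, #|e| == 2] }.

HB.instance Definition _ (V : finType) := [isSub for @edges V].
HB.instance Definition _ (V : finType) := [Finite of sgraph V by <:].

Section SimpleGraph.
Variable V : finType.

Lemma complete_card2 : [forall e in [set e : {set V} | #|e| == 2], #|e| == 2].
Proof. by apply/forall_inP => e; rewrite inE. Qed.

Definition complete_graph : sgraph V := SGraph complete_card2.

Definition adj (G : sgraph V) : rel V := fun u v => [set u; v] \in edges G.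

Definition deg (G : sgraph V) (v : V) : nat := #|[set u | adj G v u]|.

Lemma adj_irr (G : sgraph V) v : adj G v v = false.
Proof.
apply/negbTE/negP => h.
by have /forall_inP /(_ _ h) := edges_card2 G; rewrite cards2 eqxx.
Qed.

End SimpleGraph.

Section TopplingGame.
Variables (V : finType) (G : sgraph V).
Implicit Types (c : {ffun V -> nat}) (v : V).

Definition can_fire c v : bool := deg G v <= c v.

(* Only meaningful when [can_fire c v]: otherwise the subtraction truncates. *)
Definition fire c v : {ffun V -> nat} :=
  [ffun u => if u == v then c v - deg G v else c u + adj G v u].

Fixpoint fire_seq c (s : nat -> V) (k : nat) : {ffun V -> nat} :=
  if k is k'.+1 then fire (fire_seq c s k') (s k') else c.

Definition volatile c : Prop :=
  exists s : nat -> V, forall k, can_fire (fire_seq c s k) (s k).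

Definition add_chip c v : {ffun V -> nat} := [ffun u => c u + (u == v)].

Definition no_chips : {ffun V -> nat} := [ffun => 0].

(* Whatever Max does, Min can make the game end after at most [k] further
   chips, starting from [c] with Max to move iff [max_to_move]. *)
Fixpoint ends_within (k : nat) (max_to_move : bool) c : Prop :=
  volatile c \/
  match k with
  | 0 => False
  | k'.+1 => if max_to_move then forall v, ends_within k' false (add_chip c v)
             else exists v, ends_within k' true (add_chip c v)
  end.

Definition chips c : nat := \sum_v c v.

Lemma chips_fire c v : can_fire c v -> chips (fire c v) = chips c.
Proof.
move=> cv; rewrite /chips (bigD1 v) //= [RHS](bigD1 v) //= ffunE eqxx.
rewrite (eq_bigr (fun u => c u + adj G v u)); last first.
  by move=> u /negbTE uv; rewrite ffunE uv.
rewrite big_split /= [X in _ + (_ + X)](_ : _ = deg G v).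
  by rewrite addnCA addnC subnK // addnC.
rewrite /deg -sum1dep_card big_mkcond [RHS]big_mkcond /= (bigD1 v) //=.
by rewrite [RHS](bigD1 v) //= adj_irr eqxx; congr (_ + _); apply: eq_bigr => u ->; case: adj.
Qed.

Lemma chips_add c v : chips (add_chip c v) = (chips c).+1.
Proof.
rewrite /chips (eq_bigr (fun u => c u + (u == v))) => [|u _]; last by rewrite ffunE.
by rewrite big_split /= -[X in _ + X]big_mkcond /= big_pred1_eq addn1.
Qed.

Lemma can_fire_many c : \sum_v deg G v < chips c + #|V| -> exists v, can_fire c v.
Proof.
move=> many; apply/existsP; apply: contraLR many => /existsPn no.
rewrite -leqNgt /chips -sum1_card -big_split /=; apply: leq_sum => v _.
by rewrite addn1 ltnNge; apply: no.
Qed.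

Lemma volatile_many c : \sum_v deg G v < chips c + #|V| -> volatile c.
Proof.
move=> many; have [v0 _] := can_fire_many many.
pose next d := odflt v0 [pick v | can_fire d v].
pose st k := iter k (fun d => fire d (next d)) c.
have nextP d : chips d = chips c -> can_fire d (next d).
  move=> dc; have [|v dv] := @can_fire_many d; first by rewrite dc.
  by rewrite /next; case: pickP => [//|/(_ v)]; rewrite dv.
have stP k : chips (st k) = chips c.
  by elim: k => //= k IH; rewrite chips_fire // nextP.
exists (fun k => next (st k)) => k.
suff -> : fire_seq c (fun k => next (st k)) k = st k by apply: nextP.
by elim: k => //= k ->.
Qed.

Lemma ends_within_ex : exists k, `[< ends_within k true no_chips >].
Proof.
have [V0|/existsPn /= V0] := boolP [exists v : V, true]; last first.
  by exists 1; apply/asboolP; right => v; have := V0 v.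
have {V0} [v0 _] := existsP V0.
suff H k b c : \sum_v deg G v < chips c + k + #|V| -> ends_within k b c.
  exists (\sum_v deg G v).+1; apply/asboolP; apply: H.
  by rewrite addnS addSn ltnS -addnA addnCA leq_addr.
elim: k b c => [|k IH] b c h; first by left; apply: volatile_many; rewrite addn0 in h.
by right; case: b => [v|]; last exists v0; apply: IH; rewrite chips_add addSnnS.
Qed.

Definition toppling_number : nat := ex_minn ends_within_ex.

End TopplingGame.

Section BinomialRandomGraph.
Local Open Scope ring_scope.
Local Open Scope classical_set_scope.
Variable R : realType.

Definition Gnp_pmf (n : nat) (p : R) (G : sgraph 'I_n) : R :=
  \prod_(e : {set 'I_n} | #|e| == 2%N) (if e \in edges G then p else 1 - p).

Definition Gnp_prob (n : nat) (p : R) (A : pred (sgraph 'I_n)) : R :=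
  \sum_(G : sgraph 'I_n | A G) Gnp_pmf p G.

Definition Gnp_aas (p : nat -> R) (A : forall n, pred (sgraph 'I_n)) : Prop :=
  (fun n => Gnp_prob (p n) (A n)) @ \oo --> (1 : R).

End BinomialRandomGraph.

(* Main.v *)
Require Import Defs.
From mathcomp Require Import all_boot all_order all_algebra.
From mathcomp Require Import all_classical all_reals all_analysis.
From mathcomp Require Import finset.
From mathcomp Require Import zify lra ring.

Import Order.TTheory GRing.Theory Num.Theory.
Import numFieldNormedType.Exports.

(** A configuration [c] is not volatile iff some vector [k] of firing counts
    leaves every vertex unable to fire.  In a quasirandom graph of density [D]
    the number of chips received by a vertex when each [v] fires [k v] times is
    almost the same everywhere, so, if the heights [x v = c v / D] are bounded,
    volatility essentially means that [\sum_v floor (x v + s)] exceeds [s * #|V|]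
    for every real [s].  This condition does not mention the graph.  A tall vertex may be
    fired at once without affecting volatility, so heights may be assumed
    bounded.  Hence a strategy of Min can be carried over from one quasirandom
    graph to another one: play both games in parallel, at speeds proportional to
    the densities, and let Max on the first board and Min on the second one copy
    the moves made on the other board, so that the rescaled heights stay close.
    Applying this in both directions to the complete graph and to [G(n, p)],
    which is quasirandom by a Chernoff bound, gives the theorem. *)

Set Implicit Arguments.
Unset Strict Implicit.
Unset Printing Implicit Defensive.

(** * Stabilising vectors *)

Section ChipFiring.
Local Open Scope nat_scope.
Variables (V : finType) (G : sgraph V).
Implicit Types (c e : {ffun V -> nat}) (u v w : V) (k : V -> nat).

(** Quasirandomness leaves exceptional vertices, whereas volatility can hinge on a single one: a
    stabilising vector must work at every vertex. [good] therefore bounds the exceptions to a set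
    [S] by [#|S| / M], so that exceptions to exceptions shrink geometrically and vanish after [l]
    rounds, where [#|V| < 2 ^ l]. This forces firing counts up to [W], of order log n, and an error
    [delta] below the order of [W ^ -3]; it is paid for by a density that beats every power of log
    n. The volatility criterion has a gap of [eps] on either side; a final boost of about
    [4 * eps * D2] chips per vertex bridges it on the second board. The resulting additive error, of
    order [eps * n * D1 * D2], becomes relative because the toppling number of the complete graph is
    at least [n ^ 2 / 6]. *)

Lemma adj_sym : symmetric (adj G).
Proof. by move=> u v; rewrite /adj finset.setUC. Qed.

Definition nbsum k v : nat := \sum_(u | adj G v u) k u.

Lemma nbsum_le k k' v : (forall u, k u <= k' u) -> nbsum k v <= nbsum k' v.
Proof. by move=> h; apply: leq_sum. Qed.

Lemma nbsumD k k' v : nbsum (fun u => k u + k' u) v = nbsum k v + nbsum k' v.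
Proof. by rewrite /nbsum big_split. Qed.

Lemma nbsum1 v : nbsum (fun=> 1) v = deg G v.
Proof. by rewrite /nbsum /deg -sum1dep_card. Qed.

Lemma nbsumC a v : nbsum (fun=> a) v = a * deg G v.
Proof. by rewrite -nbsum1 /nbsum big_distrr /=; apply: eq_bigr => u _; rewrite muln1. Qed.

Lemma nbsumZ a k v : nbsum (fun u => a * k u) v = a * nbsum k v.
Proof. by rewrite /nbsum big_distrr. Qed.

Lemma nbsum_delta w v : nbsum (fun u => u == w) v = adj G v w.
Proof.
rewrite /nbsum big_mkcond (bigD1 w) //= eqxx big1 ?addn0; first by case: adj.
by move=> u /negbTE ->; case: ifP.
Qed.

(* After each [v] has fired [k v] times, no vertex can fire; both sides are
   arranged to avoid subtraction. *)
Definition stab c k := forall v, c v + nbsum k v < (k v).+1 * deg G v.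

Lemma volatile_cons c v : can_fire G c v -> volatile G (fire G c v) -> volatile G c.
Proof.
move=> cv [s hs]; exists (fun i => if i is j.+1 then s j else v).
have H j : fire_seq G c (fun i => if i is j.+1 then s j else v) j.+1
    = fire_seq G (fire G c v) s j by elim: j => //= j ->.
by case=> [//|j]; rewrite H.
Qed.

Lemma volatile_inv c : volatile G c -> exists2 v, can_fire G c v & volatile G (fire G c v).
Proof.
move=> [s hs]; exists (s 0); first exact: (hs 0).
exists (fun i => s i.+1) => j; have := hs j.+1.
suff -> : fire_seq G (fire G c (s 0)) (fun i => s i.+1) j = fire_seq G c s j.+1 by [].
by elim: j => //= j ->.
Qed.

(** The infinite firing sequence is built greedily: at each configuration [pick] selects a vertex
    whose firing stays inside [P]. *)
Lemma volatile_coind (P : {ffun V -> nat} -> Prop) c :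
  (forall e, P e -> exists2 v, can_fire G e v & P (fire G e v)) -> P c -> volatile G c.
Proof.
move=> step Pc; have [v0 _ _] := step c Pc.
pose next e := odflt v0 [pick v | can_fire G e v && `[< P (fire G e v) >]].
have nextP e : P e -> can_fire G e (next e) /\ P (fire G e (next e)).
  move=> /step [v h1 h2]; rewrite /next; case: pickP => [w /andP[? /asboolP]//|/(_ v)].
  by rewrite h1 /= (asboolT h2).
pose st j := iter j (fun e => fire G e (next e)) c.
have stP j : P (st j) by elim: j => //= j /nextP[].
exists (fun j => next (st j)) => j.
suff -> : fire_seq G c (fun j => next (st j)) j = st j by case: (nextP _ (stP j)).
by elim: j => //= j ->.
Qed.

(** A vertex that can fire has a positive count in every stabilising vector, and one of its firings
    can be struck off. The decrease of the total bounds the length of every legal firing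
    sequence. *)
Lemma stab_fire c k v : stab c k -> can_fire G c v ->
  exists2 k', stab (fire G c v) k' & \sum_u k' u < \sum_u k u.
Proof.
move=> st cv; have kv : 0 < k v.
  by have := st v; rewrite /can_fire in cv; case: (k v) => //; rewrite mul1n; lia.
pose k' u := k u - (u == v).
have kE u : k u = k' u + (u == v) by rewrite /k'; case: eqP => [->|_]; lia.
exists k'; last first.
  rewrite (eq_bigr _ (fun u _ => kE u)) big_split /= -[X in _ < _ + X]big_mkcond /=.
  by rewrite big_pred1_eq addn1.
move=> u; have := st u; rewrite /nbsum (eq_bigr _ (fun u _ => kE u)) -/(nbsum _ _) nbsumD nbsum_delta.
rewrite -/(nbsum k' u) ffunE (kE u); case: eqP => [->|_] /=; last by rewrite addn0 adj_sym; lia.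
rewrite adj_irr addn0 addn1; rewrite /can_fire in cv; nia.
Qed.

Lemma stab_unfire c k v : can_fire G c v -> stab (fire G c v) k ->
  stab c (fun u => k u + (u == v)).
Proof.
move=> cv st u; have := st u; rewrite nbsumD nbsum_delta ffunE.
case: eqP => [->|_] /=; last by rewrite addn0 adj_sym; lia.
rewrite adj_irr addn0 addn1; rewrite /can_fire in cv; nia.
Qed.

Lemma stab_nonvolatile c k : stab c k -> ~ volatile G c.
Proof.
have [m] := ubnP (\sum_u k u); elim: m c k => // m IH c k; rewrite ltnS => km st.
move=> /volatile_inv [v cv vol]; have [k' st' lt] := stab_fire st cv.
by apply: (IH _ k' _ st') vol; apply: leq_trans lt km.
Qed.

(** Having no stabilising vector survives every legal firing by [stab_unfire], and such a
    configuration is never stuck, since the zero vector would then stabilise it. *)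
Lemma nonvolatile_stab c : ~ volatile G c -> exists k, stab c k.
Proof.
move=> nv; apply: contrapT => nk; apply: nv.
apply: (@volatile_coind (fun e => ~ exists k, stab e k)) nk => e nk.
have [/existsP [v cv]|/existsPn no] := boolP [exists v, can_fire G e v].
  by exists v => // -[k st]; apply: nk; eexists; apply: stab_unfire cv st.
exfalso; apply: nk; exists (fun=> 0) => v; rewrite nbsumC mul0n addn0 mul1n.
by rewrite ltnNge; apply: no.
Qed.

Lemma volatile_fire c v : can_fire G c v -> volatile G c -> volatile G (fire G c v).
Proof.
move=> cv vol; apply: contrapT => /nonvolatile_stab [k st].
exact: stab_nonvolatile (stab_unfire cv st) vol.
Qed.

Lemma volatile_mono c e : (forall v, c v <= e v) -> volatile G c -> volatile G e.
Proof.
move=> le vol; apply: contrapT => /nonvolatile_stab [k st].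
apply: (@stab_nonvolatile c k) vol => v; apply: leq_ltn_trans (st v).
by rewrite leq_add2r.
Qed.

(* The Laplacian kills constants, so a stabilising vector can be shifted. *)
Lemma stab_zero (v0 : V) c k : stab c k -> exists2 k', stab c k' & exists v, k' v = 0.
Proof.
have [m] := ubnP (\sum_u k u); elim: m k => // m IH k; rewrite ltnS => km st.
have [/existsP [v /eqP v0k]|/existsPn no] := boolP [exists v, k v == 0].
  by exists k => //; exists v.
have kE u : k u = (k u).-1 + 1 by have := no u; lia.
apply: (IH (fun u => (k u).-1)); last first.
  move=> v; have := st v; rewrite /nbsum (eq_bigr _ (fun u _ => kE u)) -!/(nbsum _ _).
  by rewrite nbsumD nbsumC (kE v); nia.
apply: leq_trans km; rewrite [X in _ < X](eq_bigr _ (fun u _ => kE u)) big_split /=.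
by rewrite sum1_card -[X in X < _]addn0 ltn_add2l; apply/card_gt0P; exists v0.
Qed.

(** * Reachable configurations and semi-stabilisation *)

Inductive reach c : {ffun V -> nat} -> Prop :=
| reach_refl : reach c c
| reach_step e v : reach c e -> can_fire G e v -> reach c (fire G e v).

Lemma reach_chips c e : reach c e -> chips e = chips c.
Proof. by elim=> // {}e v _ <- ev; rewrite chips_fire. Qed.

Lemma reach_volatile c e : reach c e -> volatile G c -> volatile G e.
Proof. by elim=> // {}e v _ IH ev /IH; apply: volatile_fire. Qed.

Lemma reach_trans c e f : reach c e -> reach e f -> reach c f.
Proof. by move=> ce; elim=> // {}f v _ IH; apply: reach_step. Qed.

(** Extra chips never block a firing, so those put on [e] can be put on [c] instead. Thus a boost
    computed for a semi-stabilised board applies to the board actually played. *)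
Lemma reach_volatileD c e f : reach c e ->
  volatile G [ffun v => e v + f v] -> volatile G [ffun v => c v + f v].
Proof.
elim=> // {}e v _ IH ev vol; apply: IH.
have cv : can_fire G [ffun u => e u + f u] v.
  by rewrite /can_fire ffunE; apply: leq_trans ev (leq_addr _ _).
apply: (volatile_cons cv); apply: volatile_mono vol => u; rewrite !ffunE.
by rewrite /can_fire in ev; case: eqP => [->|_]; lia.
Qed.

Lemma reach_add_chip c e v : reach c e -> reach (add_chip c v) (add_chip e v).
Proof.
elim=> [|{}e w _ IH ew]; first exact: reach_refl.
have cw : can_fire G (add_chip e v) w.
  by rewrite /can_fire ffunE; apply: leq_trans ew (leq_addr _ _).
suff -> : add_chip (fire G e w) v = fire G (add_chip e v) w by apply: reach_step.
by apply/ffunP => u; rewrite !ffunE; rewrite /can_fire in ew; case: eqP => [->|_]; lia.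
Qed.

(** Only vertices that keep [cap] chips after firing are fired, so an invariant insensitive to
    heights above [cap] can be maintained. A stabilising vector bounds the number of firings. *)
Lemma semistabilize (cap : nat) (P : {ffun V -> nat} -> Prop) c :
    (forall e v, P e -> cap + deg G v <= e v -> P (fire G e v)) ->
    P c -> ~ volatile G c ->
  exists e, [/\ reach c e, P e & forall v, e v < cap + deg G v].
Proof.
move=> step Pc /nonvolatile_stab [k].
have [m] := ubnP (\sum_u k u); elim: m c k Pc => // m IH c k Pc; rewrite ltnS => km st.
have [/existsP [v cv]|/existsPn no] := boolP [exists v, cap + deg G v <= c v]; last first.
  by exists c; split=> //; [exact: reach_refl | move=> v; rewrite ltnNge].
have fv : can_fire G c v by apply: leq_trans cv; apply: leq_addl.
have [k' st' lt] := stab_fire st fv.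
have [||e [re Pe he]] := IH (fire G c v) k' _ _ st'; first exact: step.
  exact: leq_trans lt km.
by exists e; split=> //; apply: reach_trans re; apply: reach_step fv; apply: reach_refl.
Qed.

End ChipFiring.

(** * Volatility in quasirandom graphs *)

Section Quasirandom.
Local Open Scope ring_scope.
Variables (R : realType) (V : finType).
Implicit Types (G : sgraph V) (S : {set V}).

Definition degin G S (v : V) : nat := nbsum G (fun u => (u \in S) : nat) v.

(** [D] is the nominal degree. Exceptions are counted against [#|S|] rather than [#|V|], so the
    property can be iterated with [S] itself a set of exceptions. *)
Record good G (D : nat) (delta : R) (M : nat) : Prop := Good {
  good_deg : forall v, (1 - delta) * D%:R <= (deg G v)%:R <= (1 + delta) * D%:R;
  good_high : forall S, (M * #|[set v | (D%:R * #|S|%:R / #|V|%:R + delta * D%:R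
                                         < (degin G S v)%:R)%R]%SET| <= #|S|)%N;
  good_low : forall S, (M * #|[set v | ((degin G S v)%:R
                                        < D%:R * #|S|%:R / #|V|%:R - delta * D%:R)%R]%SET| <= #|S|)%N }.

Variables (G : sgraph V) (D : nat) (delta : R) (M : nat).
Hypothesis gd : good G D delta M.

(** Quasirandomness speaks of sets only, so a firing vector bounded by [W] is treated as a sum of
    [W] indicators of level sets. *)
Lemma layer_cake (W : nat) (k : V -> nat) u : (k u <= W)%N ->
  k u = (\sum_(j < W) (u \in [set x | (j < k x)%N]%SET))%N.
Proof.
move=> kW; transitivity (\sum_(j < W | (j < k u)%N) 1)%N; last first.
  by rewrite big_mkcond; apply: eq_bigr => j _; rewrite inE; case: ifP.
by rewrite (big_ord_narrow kW) sum1_card card_ord.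
Qed.

Lemma nbsum_layers (W : nat) (k : V -> nat) v : (forall u, k u <= W)%N ->
  nbsum G k v = (\sum_(j < W) degin G [set x | (j < k x)%N]%SET v)%N.
Proof.
move=> kW; rewrite /degin /nbsum exchange_big /=.
by apply: eq_bigr => u _; apply: layer_cake.
Qed.

Lemma sum_layers (W : nat) (k : V -> nat) : (forall u, k u <= W)%N ->
  (\sum_u k u = \sum_(j < W) #|[set x | (j < k x)%N]%SET|)%N.
Proof.
move=> kW; rewrite (eq_bigr _ (fun u _ => layer_cake (kW u))) exchange_big /=.
apply: eq_bigr => j _; rewrite -sum1_card [RHS]big_mkcond /=.
by apply: eq_bigr => u _; rewrite !inE; case: ifP.
Qed.

Lemma card_cover (W : nat) (B : {set V}) (C : 'I_W -> {set V}) :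
  (forall v, v \in B -> exists j, v \in C j) -> (#|B| <= \sum_(j < W) #|C j|)%N.
Proof.
move=> cov; rewrite -sum1_card (eq_bigr _ (fun j _ => esym (sum1_card (mem (C j))))).
rewrite big_mkcond /= (eq_bigr _ (fun j _ => big_mkcond _ _)) exchange_big /=.
apply: leq_sum => v _; case: ifP => // /cov [j vj].
by rewrite (bigD1 j) //= vj.
Qed.

(** Both the errors [delta * D] and the exceptional sets of the [W] layers add up. *)
Lemma few_high (W : nat) (k : V -> nat) : (forall u, k u <= W)%N ->
  (M * #|[set v | (D%:R * (\sum_u k u)%N%:R / #|V|%:R + W%:R * (delta * D%:R)
                    < (nbsum G k v)%:R)%R]%SET| <= W * #|V|)%N.
Proof.
move=> kW; pose A (j : 'I_W) := [set x | (j < k x)%N]%SET.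
have := @card_cover W _ (fun j => [set v | (D%:R * #|A j|%:R / #|V|%:R + delta * D%:R
                                        < (degin G (A j) v)%:R)%R]%SET).
move/(_ [set v | (D%:R * (\sum_u k u)%N%:R / #|V|%:R + W%:R * (delta * D%:R)
                    < (nbsum G k v)%:R)%R]%SET) => cov.
apply: (@leq_trans (M * (\sum_j #|[set v | (D%:R * #|A j|%:R / #|V|%:R + delta * D%:R
                                        < (degin G (A j) v)%:R)%R]%SET|))).
  rewrite leq_mul2l cov ?orbT // => v; rewrite inE => hv.
  apply: contrapT => no; move: hv; apply/negP; rewrite -leNgt.
  have constE : W%:R * (delta * D%:R) = \sum_(j < W) delta * D%:R.
    by rewrite sumr_const card_ord mulr_natl.
  rewrite (nbsum_layers _ kW) (sum_layers kW) !natr_sum.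
  rewrite mulr_sumr mulr_suml constE -big_split /=.
  apply: ler_sum => j _; rewrite leNgt; apply/negP => hj; apply: no; exists j.
  by rewrite inE.
apply: (@leq_trans (\sum_(j < W) #|V|)); last by rewrite sum_nat_const card_ord.
rewrite big_distrr /=; apply: leq_sum => j _; apply: leq_trans (max_card _).
exact: (good_high gd).
Qed.

Lemma few_low (W : nat) (k : V -> nat) : (forall u, k u <= W)%N ->
  (M * #|[set v | ((nbsum G k v)%:R
            < D%:R * (\sum_u k u)%N%:R / #|V|%:R - W%:R * (delta * D%:R))%R]%SET| <= W * #|V|)%N.
Proof.
move=> kW; pose A (j : 'I_W) := [set x | (j < k x)%N]%SET.
have := @card_cover W _ (fun j => [set v | ((degin G (A j) v)%:R <
  D%:R * #|A j|%:R / #|V|%:R - delta * D%:R)%R]%SET).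
move/(_ [set v | ((nbsum G k v)%:R
            < D%:R * (\sum_u k u)%N%:R / #|V|%:R - W%:R * (delta * D%:R))%R]%SET) => cov.
apply: (@leq_trans (M * (\sum_j #|[set v | ((degin G (A j) v)%:R <
  D%:R * #|A j|%:R / #|V|%:R - delta * D%:R)%R]%SET|))).
  rewrite leq_mul2l cov ?orbT // => v; rewrite inE => hv.
  apply: contrapT => no; move: hv; apply/negP; rewrite -leNgt.
  have constE : W%:R * (delta * D%:R) = \sum_(j < W) delta * D%:R.
    by rewrite sumr_const card_ord mulr_natl.
  rewrite (nbsum_layers _ kW) (sum_layers kW) !natr_sum.
  rewrite mulr_sumr mulr_suml constE -sumrB /=.
  apply: ler_sum => j _; rewrite leNgt; apply/negP => hj; apply: no; exists j.
  by rewrite inE.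
apply: (@leq_trans (\sum_(j < W) #|V|)); last by rewrite sum_nat_const card_ord.
rewrite big_distrr /=; apply: leq_sum => j _; apply: leq_trans (max_card _).
exact: (good_low gd).
Qed.

Variables (l H W : nat) (eps : R).
Hypothesis HlW : (H + l + 3 <= W)%N.
Hypothesis D0 : (0 < D)%N.
Hypothesis V0 : (0 < #|V|)%N.
Hypothesis Vl : (#|V| < 2 ^ l)%N.
Hypothesis eps01 : 0 < eps <= 1.
Hypothesis delta0 : 0 <= delta.
Hypothesis deltaW : 32 * W%:R ^+ 3 * delta <= eps.
Hypothesis WM : 8 * W%:R ^+ 2 <= eps * M%:R.
Hypothesis WdM : W%:R <= delta * M%:R.

Let DR0 : 0 < D%:R :> R. Proof. by rewrite ltr0n. Qed.
Let VR0 : 0 < #|V|%:R :> R. Proof. by rewrite ltr0n. Qed.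
Let W3 : 3 <= W%:R :> R. Proof. by rewrite ler_nat; lia. Qed.
Let sq9 (w : R) : 3 <= w -> 9 <= w ^+ 2. Proof. by move=> h; nra. Qed.
Let M0 : 72 <= M%:R :> R.
Proof.
have /andP[e0 e1] := eps01; have h := sq9 W3.
have : 72 <= eps * M%:R by have := WM; lra.
have := ler_wpM2r (ler0n R M) e1; lra.
Qed.
Let Wd : 32 * 9 * (W%:R * delta) <= eps.
Proof.
apply: le_trans deltaW; have h := sq9 W3.
have /ler_wpM2r /(_ _ _ h) : 0 <= W%:R * delta by rewrite mulr_ge0.
lra.
Qed.

Lemma leq_scaled_card (m a : nat) : (M * m <= a)%N -> m%:R * M%:R <= a%:R :> R.
Proof. by move=> h; rewrite -natrM ler_nat mulnC. Qed.

(* The level sets [k < j] at least halve when [j] decreases, since a vertex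
   firing fewer than [j - 1] times has many neighbours firing fewer than [j]. *)
Lemma stab_level_step (z : {ffun V -> nat}) k j : stab G z k -> (0 < j <= l)%N ->
  (M * #|[set v | (k v < j.+1)%N]%SET| <= W * #|V|)%N ->
  (2 * #|[set v | (k v < j)%N]%SET| <= #|[set v | (k v < j.+1)%N]%SET|)%N.
Proof.
move=> st /andP[j0 jl] few; set E := [set v | (k v < j.+1)%N]%SET.
suff sub : [set v | (k v < j)%N]%SET \subset [set v | (D%:R * #|E|%:R / #|V|%:R + delta * D%:R
                                         < (degin G E v)%:R)%R]%SET.
  apply: leq_trans (good_high gd E); apply: leq_mul (subset_leq_card sub).
  by rewrite -(ler_nat R); have := M0; lra.
apply/fintype.subsetP => v; rewrite !inE => vj.
have /andP[dlo dhi] := good_deg gd v.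
(* Outside [E] the count is at least [j.+1], so [j.+1 <= k u + j.+1 * (u \in E)] at every [u].
   Against [st v] this leaves [v] with more than [deg G v / j.+1] neighbours in [E], far above the
   typical number. *)
have h1 : (j.+1 * deg G v <= nbsum G k v + j.+1 * degin G E v)%N.
  rewrite -nbsumC -nbsumZ -nbsumD; apply: nbsum_le => u; rewrite inE.
  by case: (ltnP (k u) j.+1) => h; clear -h; lia.
have h2 : (deg G v < j.+1 * degin G E v)%N.
  move: h1 (st v) (leq_mul vj (leqnn (deg G v))); clear; rewrite !mulSn; lia.
have {}h2 : (deg G v)%:R < (j%:R + 1) * (degin G E v)%:R :> R.
  by rewrite natr1 -natrM ltr_nat.
have jW : j%:R + 1 <= W%:R :> R by rewrite natr1 ler_nat; move: jl HlW; clear; lia.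
have {}few := leq_scaled_card few; rewrite -/E natrM in few.
have h3 : #|E|%:R <= delta * #|V|%:R :> R.
  have h : #|E|%:R * M%:R <= (delta * #|V|%:R) * M%:R.
    by have := ler_wpM2r (ltW VR0) WdM; lra.
  by rewrite -(ler_pM2r (x := M%:R)) //; have := M0; lra.
have h4 : D%:R * #|E|%:R / #|V|%:R <= delta * D%:R.
  by rewrite ler_pdivrMr //; have := ler_wpM2l (ltW DR0) h3; lra.
have h5 : (deg G v)%:R < W%:R * (degin G E v)%:R :> R.
  by apply: lt_le_trans h2 _; apply: ler_wpM2r.
have h6 : (W%:R * (2 * delta)) * D%:R <= (1 - delta) * D%:R.
  apply: ler_wpM2r => //; have /andP[e0 e1] := eps01; have := Wd.
  have : 0 <= W%:R * delta by rewrite mulr_ge0.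
  have : delta <= W%:R * delta by rewrite ler_peMl //; have := W3; lra.
  lra.
rewrite -(ltr_pM2l (x := W%:R)); last by have := W3; lra.
have := ler_wpM2l (ler0n R W) h4; lra.
Qed.

(** Going down from level [l.+1] to level 1 halves the level set [l] times, which leaves fewer than
    one vertex. *)
Lemma stab_all_fire (z : {ffun V -> nat}) k : stab G z k ->
  (M * #|[set v | (k v < l.+1)%N]%SET| <= W * #|V|)%N -> forall v, (0 < k v)%N.
Proof.
move=> st few.
have few' j : (j <= l.+1)%N -> (M * #|[set v | (k v < j)%N]%SET| <= W * #|V|)%N.
  move=> jl; apply: leq_trans few; rewrite leq_mul2l subset_leq_card ?orbT //.
  by apply/fintype.subsetP => v; rewrite !inE => h; clear -h jl; lia.
have H1 i : (i <= l)%N -> (2 ^ i * #|[set v | (k v < l.+1 - i)%N]%SET| <= #|V|)%N.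
  elim: i => [_|i IH il]; first by rewrite expn0 mul1n max_card.
  apply: leq_trans (IH (ltnW il)); rewrite expnSr -mulnA leq_mul2l; apply/orP; right.
  rewrite (_ : l.+1 - i = (l - i).+1)%N; last by clear -il; lia.
  by rewrite subSS; apply: (stab_level_step st); [clear -il; lia | apply: few'; clear -il; lia].
have {H1} := H1 l (leqnn l); rewrite subSn // subnn => H1.
have {}H1 : #|[set v | (k v < 1)%N]%SET| = 0%N.
  by case: #|_| H1 => // a; rewrite mulnS => H1; have := Vl; lia.
move=> v; move/eqP: H1; rewrite cards_eq0 => /eqP H1.
rewrite lt0n -leqn0 -ltnS; have := in_set0 v.
by rewrite -H1 inE => ->.
Qed.

(* By induction on [s], in steps of [eps / 4], nearly every vertex fires at least
   [floor (x v + s - eps / 4)] times; at [s] about [l] this forces all vertices to fire. *)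
Lemma robust_volatile (z : {ffun V -> nat}) : (forall v, z v <= H * D)%N ->
  (forall s : R, (s + eps) * #|V|%:R <= (\sum_v Num.truncn ((z v)%:R / D%:R + s))%N%:R) ->
  volatile G z.
Proof.
move=> zH rob; apply: contrapT => /nonvolatile_stab [k0 st0].
have /card_gt0P [v0 _] := V0.
(* The vertex [v1] that never fires is what [stab_all_fire] contradicts in the end. *)
have {k0 st0} [k st [v1 kv1]] := stab_zero v0 st0.
have /andP[e0 e1] := eps01.
pose x v := (z v)%:R / D%:R : R.
have x0 v : 0 <= x v by rewrite divr_ge0.
have xH v : x v <= H%:R by rewrite ler_pdivrMr // -natrM ler_nat.
(* The offset [eps / 4] absorbs the factor [1 + delta] of the degrees, so that [E 0] is empty. *)
pose f s v := Num.truncn (x v + s - eps / 4).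
pose E s := [set v | (k v < f s v)%N]%SET.
have stR v : (z v)%:R + (nbsum G k v)%:R < ((k v)%:R + 1) * (1 + delta) * D%:R :> R.
  have /andP[_ dv] := good_deg gd v.
  rewrite -natrD; apply: (@lt_le_trans _ _ (((k v).+1 * deg G v)%N%:R)).
    by rewrite ltr_nat.
  by rewrite natrM -natr1 -mulrA ler_wpM2l.
have zx v : (z v)%:R = x v * D%:R by rewrite /x divfK // gt_eqF.
have HW : H%:R + (l%:R + 2) <= W%:R - 1 :> R.
  by have : (H + l + 3)%N%:R <= W%:R :> R; [rewrite ler_nat | rewrite !natrD; lra].
have l0 := ler0n R l.
have lt_k (y : R) v : y < (k v)%:R + 1 -> (Num.truncn y <= k v)%N.
  by move=> h; rewrite truncn_le_nat -natr1.
have small v (y : R) : x v + y <= W%:R -> x v + y + eps / 4 < ((k v)%:R + 1) * (1 + delta) ->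
    x v + y < (k v)%:R + 1.
  move=> yW h; rewrite ltNge; apply/negP => h'.
  have : ((k v)%:R + 1) * delta <= W%:R * delta by apply: ler_wpM2r => //; lra.
  have := Wd; lra.
have base : (M * #|E 0%R| <= W * #|V|)%N.
  suff -> : E 0%R = set0 by rewrite cards0 muln0.
  apply/setP => v; rewrite !inE ltnNge /f; apply/negbTE; rewrite negbK.
  apply: lt_k; rewrite addr0; apply: small; first by have := xH v; lra.
  rewrite subrK; have := stR v; rewrite zx => h.
  rewrite -(ltr_pM2r (x := D%:R)) //; apply: le_lt_trans h.
  by rewrite lerDl.
have step (s : R) : 0 <= s <= l%:R + 2 -> (M * #|E s| <= W * #|V|)%N ->
    (M * #|E (s + eps / 4)%R| <= W * #|V|)%N.
  move=> /andP[s0 sl] few.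
  have fW v : (f s v <= W)%N.
    rewrite /f truncn_le_nat -[W.+1%:R]natr1; have := xH v; lra.
  (* [few_low] needs counts bounded by [W]. Capping at [f s] only lowers what the neighbours send,
     and the total stays within [W] per vertex of [E s] of the sum of [f s]. *)
  pose k' v := minn (k v) (f s v).
  have k'W v : (k' v <= W)%N by rewrite /k' geq_min fW orbT.
  apply: leq_trans (few_low k'W); rewrite leq_mul2l subset_leq_card ?orbT //.
  apply/fintype.subsetP => v; rewrite !inE => vE; rewrite ltNge; apply/negP => hv.
  have sumf : (s + 3 / 4 * eps) * #|V|%:R <= (\sum_v f s v)%N%:R.
    have := rob (s - eps / 4); rewrite (_ : s - eps / 4 + eps = s + 3 / 4 * eps); last lra.
    move=> /le_trans; apply; rewrite ler_nat; apply: leq_sum => u _.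
    by rewrite /f addrA.
  have sumk : (\sum_v f s v <= \sum_v k' v + W * #|E s|)%N.
    rewrite -sum1_card big_distrr /= [X in (_ <= _ + X)%N]big_mkcond -big_split /=.
    apply: leq_sum => u _; rewrite inE muln1 /k'; have := fW u.
    by move: (f s u) (k u) => a b; clear; case: ifP; lia.
  have {}few := leq_scaled_card few; rewrite natrM in few.
  have few2 : W%:R * #|E s|%:R <= eps / 8 * #|V|%:R.
    have h : W%:R * #|E s|%:R * M%:R <= (eps / 8 * #|V|%:R) * M%:R.
      have := ler_wpM2l (ler0n R W) few.
      have := ler_wpM2r (ltW VR0) WM.
      lra.
    by rewrite -(ler_pM2r (x := M%:R)) //; have := M0; lra.
  have sumk' : (s + 5 / 8 * eps) * #|V|%:R <= (\sum_v k' v)%N%:R.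
    have : (\sum_v f s v)%N%:R <= (\sum_v k' v)%N%:R + W%:R * #|E s|%:R :> R.
      by rewrite -natrM -natrD ler_nat.
    lra.
  have nb : (s + eps / 2) * D%:R <= (nbsum G k v)%:R.
    apply: (@le_trans _ _ (nbsum G k' v)%:R); last first.
      by rewrite ler_nat; apply: nbsum_le => u; rewrite geq_minl.
    apply: le_trans hv; rewrite -mulrA.
    have : s + 5 / 8 * eps <= (\sum_u k' u)%N%:R / #|V|%:R by rewrite ler_pdivlMr.
    move=> /(ler_wpM2l (ltW DR0)).
    have := ler_wpM2r (ltW DR0) Wd; have := mulr_ge0 (ltW e0) (ltW DR0); lra.
  move: vE; rewrite ltnNge => /negP; apply; apply: lt_k.
  rewrite addrA addrK; apply: small; first by have := xH v; lra.
  rewrite -(ltr_pM2r (x := D%:R)) //; apply: le_lt_trans (stR v).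
  rewrite zx; have := mulr_ge0 (ltW e0) (ltW DR0); lra.
have iter i : i%:R * (eps / 4) <= l%:R + 2 + eps / 4 -> (M * #|E (i%:R * (eps / 4))%R| <= W * #|V|)%N.
  elim: i => [|i IH]; first by rewrite mul0r.
  rewrite -natr1 mulrDl mul1r => hi; apply: step; last by apply: IH; lra.
  apply/andP; split; last by lra.
  by apply: mulr_ge0; [exact: ler0n | lra].
pose i := Num.truncn ((l%:R + 2) / (eps / 4)).
have /andP[i1 i2] : i%:R <= (l%:R + 2) / (eps / 4) < i.+1%:R.
  by apply: truncn_itv; apply: divr_ge0; lra.
have e40 : 0 < eps / 4 by lra.
rewrite ler_pdivlMr // in i1; rewrite ltr_pdivrMr // -[i.+1%:R]natr1 in i2.
have fin : (M * #|[set v | (k v < l.+1)%N]%SET| <= W * #|V|)%N.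
  apply: leq_trans (iter i _); last by lra.
  rewrite leq_mul2l subset_leq_card ?orbT //; apply/fintype.subsetP => v; rewrite !inE => h.
  apply: leq_trans h _; rewrite /f truncn_ge_nat -?[l.+1%:R]natr1; have := x0 v; lra.
by have := stab_all_fire st fin v1; rewrite kv1.
Qed.

Lemma truncn_addn (y : R) i : 0 <= y -> Num.truncn (y + i%:R) = (Num.truncn y + i)%N.
Proof.
by move=> y0; apply: truncn_def; have := truncn_itv y0; rewrite -!natr1 natrD; lra.
Qed.

(** Removing the integer part of [s] changes both sides by the same multiple of [#|V|]. A shift
    below 1 keeps the firing counts [floor (x v + s)] at most [H.+1]. *)
Lemma deficit_frac (z : {ffun V -> nat}) (s : R) :
    (\sum_v Num.truncn ((z v)%:R / D%:R + s))%N%:R < (s - eps) * #|V|%:R ->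
  exists2 t : R, eps < t < 1 &
    (\sum_v Num.truncn ((z v)%:R / D%:R + t))%N%:R < (t - eps) * #|V|%:R.
Proof.
move=> def; have /andP[e0 e1] := eps01.
have se : 0 < s - eps.
  by rewrite -(pmulr_lgt0 _ VR0) (le_lt_trans _ def).
have /andP[i1 i2] : (Num.truncn s)%:R <= s < (Num.truncn s).+1%:R by apply: truncn_itv; lra.
rewrite -natr1 in i2; set i := Num.truncn s in i1 i2.
have lt' : (\sum_v Num.truncn ((z v)%:R / D%:R + (s - i%:R)))%N%:R < (s - i%:R - eps) * #|V|%:R.
  rewrite (_ : (s - i%:R - eps) * #|V|%:R = (s - eps) * #|V|%:R - #|V|%:R * i%:R); last by ring.
  rewrite ltrBrDr; apply: le_lt_trans def.
  rewrite -natrM -natrD ler_nat -sum_nat_const -big_split /=; apply: leq_sum => v _.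
  rewrite -truncn_addn; last by rewrite addr_ge0 ?divr_ge0 // subr_ge0.
  by rewrite -addrA subrK.
exists (s - i%:R) => //; apply/andP; split; last by lra.
have : 0 < s - i%:R - eps by rewrite -(pmulr_lgt0 _ VR0) (le_lt_trans _ lt').
lra.
Qed.

(* The exceptional vertices [B 0] of the uniform firing vector are repaired by
   extra firings, which creates far fewer exceptional vertices [B 1], and so on. *)
Lemma deficit_nonvolatile (z : {ffun V -> nat}) (s : R) : (forall v, z v <= H * D)%N ->
  (\sum_v Num.truncn ((z v)%:R / D%:R + s))%N%:R < (s - eps) * #|V|%:R ->
  ~ volatile G z.
Proof.
move=> zH /deficit_frac [{}s /andP[es s1] def].
have /andP[e0 e1] := eps01.
pose x v := (z v)%:R / D%:R : R.
have x0 v : 0 <= x v by rewrite divr_ge0.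
have xH v : x v <= H%:R by rewrite ler_pdivrMr // -natrM ler_nat.
have zx v : (z v)%:R = x v * D%:R by rewrite /x divfK // gt_eqF.
pose k v := Num.truncn (x v + s).
have xk v : x v + s < (k v)%:R + 1 by rewrite natr1 truncnS_gt.
have kH v : (k v <= H.+1)%N.
  by rewrite /k truncn_le_nat -[H.+2%:R]natr1 -[H.+1%:R]natr1; have := xH v; lra.
have l_gt0 : (0 < l)%N by case: (posnP l) Vl => // ->; rewrite expn0; move: V0; clear; lia.
pose B0 := [set v | (D%:R * (\sum_u k u)%N%:R / #|V|%:R + H.+1%:R * (delta * D%:R)
                    < (nbsum G k v)%:R)%R]%SET.
pose B := fix B i := if i is i'.+1 then
  [set v | (2 * (delta * D%:R) < (degin G (B i') v)%:R)%R]%SET else B0.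
have MB i : (M * #|B i| <= W * #|V|)%N /\ (2 ^ i * #|B i| <= #|V|)%N.
  elim: i => [|i [IH1 IH2]].
    split; last by rewrite expn0 mul1n max_card.
    apply: leq_trans (few_high kH) _; rewrite leq_mul2r; apply/orP; right.
    by move: HlW; clear; lia.
  have dB : D%:R * #|B i|%:R / #|V|%:R <= delta * D%:R.
    have {}IH1 := leq_scaled_card IH1; rewrite natrM in IH1.
    have h3 : #|B i|%:R <= delta * #|V|%:R :> R.
      have h : #|B i|%:R * M%:R <= (delta * #|V|%:R) * M%:R.
        by have := ler_wpM2r (ltW VR0) WdM; lra.
      by rewrite -(ler_pM2r (x := M%:R)) //; have := M0; lra.
    by rewrite ler_pdivrMr //; have := ler_wpM2l (ltW DR0) h3; lra.
  have sub : (M * #|B i.+1| <= #|B i|)%N.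
    apply: leq_trans (good_high gd (B i)); rewrite leq_mul2l subset_leq_card ?orbT //.
    by apply/fintype.subsetP => v; rewrite !inE; apply: le_lt_trans; lra.
  have M2 : (2 <= M)%N by rewrite -(ler_nat R); have := M0; lra.
  have sub2 : (2 * #|B i.+1| <= #|B i|)%N by apply: leq_trans sub; rewrite leq_mul2r M2 orbT.
  split; first by apply: leq_trans IH1; rewrite leq_mul2l; move: sub2; clear; lia.
  by apply: leq_trans IH2; rewrite expnSr -mulnA leq_mul2l sub2 orbT.
have Bl v : v \in B l = false.
  have [_ h] := MB l; have : #|B l| = 0%N.
    by case: #|B l| h => // a; rewrite mulnS; move: Vl; clear; lia.
  by move/eqP; rewrite cards_eq0 => /eqP ->; rewrite inE.
(* One more than the last round at which [v] is exceptional, and 0 if there is none. If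
   [lev v <= j.+1], then [v] lies outside [B j.+1] and has few neighbours in [B j]; so, up to a
   small error, the neighbours of [v] have level at most [(lev v).-1]. *)
pose lev v := (\max_(j < l | v \in B j) j.+1)%N.
have levB v j : (j < l)%N -> v \in B j -> (j < lev v)%N.
  by move=> jl vj; rewrite /lev (leq_bigmax_cond (F := fun j : 'I_l => j.+1) (Ordinal jl)).
have lev_small u m : (lev u <= m.-1 + l * \sum_(j < l | (m <= j.+1)%N) (u \in B j))%N.
  have [|h] := leqP (lev u) m.-1; first by move/leq_trans; apply; apply: leq_addr.
  have /card_gt0P [j0 uj0] : (0 < #|[pred j : 'I_l | u \in B j]|)%N.
    rewrite lt0n; apply/negP => /eqP /card0_eq c0; move: h; rewrite /lev big1 // => j.
    by have := c0 j; rewrite !inE => ->.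
  have [|j uj ej] := @eq_bigmax_cond _ [pred j : 'I_l | u \in B j] (fun j : 'I_l => j.+1).
    by apply/card_gt0P; exists j0.
  have {}ej : lev u = j.+1 by rewrite -ej; apply: eq_bigl.
  rewrite ej in h *; rewrite (bigD1 j) /=; last by move: h; clear; lia.
  rewrite inE in uj; rewrite uj mulnDr muln1 addnCA; apply: leq_trans (ltn_ord j) _.
  exact: leq_addr.
(* An exceptional vertex holds at most [H * D <= 2 * H * deg] chips and receives at most
   [(H + 1) * deg] from [k]. Firing it [h] times more per level, of which its neighbours return one
   level less, disposes of all these. *)
pose h := (3 * H + 1)%N.
have levR v : (nbsum G lev v)%:R <= ((lev v).-1 * deg G v)%N%:R + 2 * (W%:R ^+ 2 * delta) * D%:R.
  apply: (@le_trans _ _ ((lev v).-1 * deg G v + l * \sum_(j < l | (lev v <= j.+1)%N) degin G (B j) v)%N%:R).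
    rewrite ler_nat -nbsumC /degin exchange_big /= -nbsumZ -nbsumD.
    by apply: nbsum_le => u; apply: lev_small.
  have dj (j : 'I_l) : (lev v <= j.+1)%N -> (degin G (B j) v)%:R <= 2 * (delta * D%:R).
    move=> lj; rewrite leNgt; apply/negP => hj.
    have vB : v \in B j.+1 by rewrite inE.
    have [jl|jl] := ltnP j.+1 l; first by have := levB _ _ jl vB; move: lj; clear; lia.
    by have e : j.+1 = l by [move: (ltn_ord j) jl; clear; lia]; rewrite e Bl in vB.
  rewrite natrD lerD2l natrM natr_sum.
  have : \sum_(j < l | (lev v <= j.+1)%N) (degin G (B j) v)%:R <= l%:R * (2 * (delta * D%:R)).
    apply: (@le_trans _ _ (\sum_(j < l | (lev v <= j.+1)%N) 2 * (delta * D%:R))).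
      by apply: ler_sum.
    apply: (@le_trans _ _ (\sum_(j < l) 2 * (delta * D%:R))).
      rewrite [leLHS]big_mkcond; apply: ler_sum => j _; case: ifP => // _.
      by rewrite !mulr_ge0.
    by rewrite sumr_const card_ord -[leLHS]mulr_natl.
  move=> /(ler_wpM2l (ler0n R l)) /le_trans; apply.
  have lW : l%:R <= W%:R :> R by rewrite ler_nat; move: HlW; clear; lia.
  have : l%:R * l%:R <= W%:R * W%:R :> R by apply: ler_pM.
  have dD : 0 <= delta * D%:R by rewrite mulr_ge0.
  by move/(ler_wpM2r dD); lra.
apply: (@stab_nonvolatile _ _ _ (fun v => k v + h * lev v)%N) => v.
rewrite nbsumD nbsumZ -(ltr_nat R) natrM -natr1 !natrD !natrM.
have /andP[dlo dhi] := good_deg gd v.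
have Wd2 : W%:R ^+ 2 * delta * (h%:R * 2) * 32 <= 6 * eps.
  have hW : h%:R <= 3 * W%:R :> R by rewrite -natrM ler_nat /h; move: HlW; clear; lia.
  have d2 : 0 <= W%:R ^+ 2 * delta by rewrite mulr_ge0 ?exprn_ge0.
  by have := ler_wpM2l d2 hW; have := deltaW; lra.
have Wd2D := ler_wpM2r (ltW DR0) Wd2.
have eD := mulr_ge0 (ltW e0) (ltW DR0).
have WdD := ler_wpM2r (ltW DR0) Wd.
have lv := ler_wpM2l (ler0n R h) (levR v).
have d0 := ler0n R (deg G v).
have W3' := W3.
have dW : delta <= W%:R * delta by rewrite ler_peMl //; lra.
have dWD := ler_wpM2r (ltW DR0) dW.
have e1D := ler_wpM2r (ltW DR0) e1.
(* At an unexceptional vertex the deficit [eps * D] pays for every error, including the chips sent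
   by repaired neighbours. *)
have [m0|m_gt0] := posnP (lev v).
  have vB0 : v \notin B 0%N by apply/negP => /(levB _ _ l_gt0); rewrite m0.
  have nb : (nbsum G k v)%:R <= (s - eps) * D%:R + W%:R * delta * D%:R.
    move: vB0; rewrite inE -leNgt => /le_trans; apply.
    have h1 : (\sum_u k u)%N%:R / #|V|%:R <= s - eps by rewrite ler_pdivrMr // ltW.
    have h2 : H.+1%:R <= W%:R :> R by rewrite ler_nat; move: HlW; clear; lia.
    have dD : 0 <= delta * D%:R by rewrite mulr_ge0.
    have := ler_wpM2l (ltW DR0) h1; have := ler_wpM2r dD h2; lra.
  rewrite m0 /= mul0n mulr0 addr0 in lv *; rewrite add0r in lv.
  have kd : (x v + s) * ((1 - delta) * D%:R) <= ((k v)%:R + 1) * (deg G v)%:R.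
    apply: ler_pM => //; last exact: ltW (xk v).
      by have := x0 v; lra.
    by apply: mulr_ge0; [have := Wd; lra | exact: ler0n].
  have xW : x v + s <= W%:R.
    have h2 : H.+1%:R <= W%:R :> R by rewrite ler_nat; move: HlW; clear; lia.
    by rewrite -natr1 in h2; have := xH v; lra.
  have dD : 0 <= delta * D%:R by rewrite mulr_ge0.
  have := ler_wpM2r dD xW; have eD' := mulr_gt0 e0 DR0.
  by rewrite zx; lra.
have nbk : (nbsum G k v)%:R <= (H%:R + 1) * (deg G v)%:R :> R.
  by rewrite natr1 -natrM ler_nat -nbsumC; apply: nbsum_le.
have zHR : (z v)%:R <= H%:R * D%:R :> R by rewrite -natrM ler_nat.
have D2 : D%:R <= 2 * (deg G v)%:R :> R by lra.
have HD := ler_wpM2l (ler0n R H) D2.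
have mE : (lev v)%:R = (lev v).-1%:R + 1 :> R by rewrite natr1 prednK.
have hE : h%:R = 3 * H%:R + 1 :> R by rewrite /h natrD natrM.
have kd : 0 <= (k v)%:R * (deg G v)%:R :> R by rewrite mulr_ge0.
have deg_gt0 : 0 < (deg G v)%:R :> R by have := DR0; lra.
rewrite natrM in lv; rewrite mE.
move: Wd2D lv; rewrite !hE; lra.
Qed.

End Quasirandom.

(** * Simulating one board on another *)

Section Fill.
Local Open Scope nat_scope.
Variables (V : finType) (G : sgraph V).
Implicit Types (r : {ffun V -> nat}).

Lemma ends_volatile k b r : volatile G r -> ends_within G k b r.
Proof. by case: k => [|k] vol; left. Qed.

(** Min places the chips of [f] one at a time, while the replies of Max can only help by
    monotonicity; each chip of [f] thus costs two moves. *)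
Lemma ends_fill_min q k r (f : V -> nat) : \sum_v f v <= q ->
  volatile G [ffun v => r v + f v] -> 2 * q <= k -> ends_within G k false r.
Proof.
elim: q k r f => [|q IH] k r f.
  rewrite leqn0 sum_nat_eq0 => /forallP f0 vol _; apply: ends_volatile.
  apply: volatile_mono vol => v; rewrite ffunE.
  by have /eqP -> := f0 v; rewrite addn0.
have [/existsP [v fv]|/existsPn f0] := boolP [exists v, 0 < f v]; last first.
  move=> _ vol _; apply: ends_volatile; apply: volatile_mono vol => v; rewrite ffunE.
  by have := f0 v; case: (f v) => // _; rewrite addn0.
case: k => [|[|k]] fq vol kq; [lia | lia |].
pose f' u := f u - (u == v).
have fE u : f u = f' u + (u == v) by rewrite /f'; case: eqP => [->|_]; lia.
right; exists v; right => w; apply: (IH _ _ f').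
- move: fq; rewrite (eq_bigr _ (fun u _ => fE u)) big_split /=.
  by rewrite -[X in _ + X]big_mkcond /= big_pred1_eq addn1.
- by apply: volatile_mono vol => u; rewrite !ffunE (fE u); lia.
- lia.
Qed.

Lemma ends_fill q k b r (f : V -> nat) : \sum_v f v <= q ->
  volatile G [ffun v => r v + f v] -> 2 * q < k -> ends_within G k b r.
Proof.
case: b k => -[|k] // fq vol kq; last by apply: (ends_fill_min fq vol); lia.
right => v; apply: (ends_fill_min fq); last by lia.
by apply: volatile_mono vol => u; rewrite !ffunE; lia.
Qed.

Lemma toppling_number_le k : ends_within G k true (no_chips V) -> toppling_number G <= k.
Proof. by rewrite /toppling_number => h; case: ex_minnP => m _; apply; apply/asboolP. Qed.

Lemma toppling_numberP : ends_within G (toppling_number G) true (no_chips V).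
Proof. by rewrite /toppling_number; case: ex_minnP => m /asboolP. Qed.

End Fill.

(** * The lag between two boards and the parallel game *)

Section Simulation.
Local Open Scope nat_scope.
Variables (V : finType) (G1 G2 : sgraph V) (D1 D2 J : nat).
Implicit Types (r c : {ffun V -> nat}).
Hypotheses (V_gt0 : 0 < #|V|) (D1_gt0 : 0 < D1) (D2_gt0 : 0 < D2) (J_gt0 : 0 < J).
Hypotheses (deg1 : forall v, deg G1 v <= 2 * D1) (deg2 : forall v, deg G2 v <= 2 * D2).
Let n := #|V|.
Let C := J * D1 * D2.

(* How much the second board lags behind the first one, both scaled to density
   [D1 * D2] and heights counted only up to [J]. *)
Definition lag c1 c2 : nat := \sum_v (D2 * c1 v - minn (D1 * c2 v) C).

Let adj1 (G : sgraph V) v : \sum_u adj G v u = deg G v.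
Proof. by rewrite -nbsum1 /nbsum [RHS]big_mkcond /=; apply: eq_bigr => u _; case: adj. Qed.

(** At [v] the subtraction is not truncated, as [D2 * c1 v] exceeds the cap [C] by at least
    [D2 * deg G1 v]; the drop there pays for all increases at the neighbours. *)
Lemma lag_fire1 c1 c2 v : J * D1 + deg G1 v <= c1 v -> lag (fire G1 c1 v) c2 <= lag c1 c2.
Proof.
move=> cv; rewrite -(leq_add2r (D2 * deg G1 v)) /lag.
rewrite -[in X in _ <= _ + X](adj1 G1 v) big_distrr /= -big_split /=.
rewrite (bigD1 v) //= [X in _ <= X](bigD1 v) //= addnAC; apply: leq_add.
  rewrite ffunE eqxx adj_irr muln0 addn0.
  have h : J * D1 * D2 + D2 * deg G1 v <= D2 * c1 v.
    by have := leq_mul (leqnn D2) cv; lia.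
  by have := geq_minr (D1 * c2 v) C; rewrite mulnBr; move: h; rewrite /C; lia.
apply: leq_sum => u /negbTE uv; rewrite ffunE uv mulnDr.
by move: (D2 * c1 u) (D2 * adj G1 v u) (minn _ _); clear; lia.
Qed.

Lemma lag_mono2 c1 c2 c2' : (forall v, minn (D1 * c2 v) C <= minn (D1 * c2' v) C) ->
  lag c1 c2' <= lag c1 c2.
Proof. by move=> h; apply: leq_sum => v _; apply: leq_sub2l. Qed.

(** The fired vertex stays at or above the cap, so it counts as [C] before and after, and its
    neighbours only gain. This is why the second board is capped in [lag]. *)
Lemma lag_fire2 c1 c2 v : J * D2 + deg G2 v <= c2 v -> lag c1 (fire G2 c2 v) <= lag c1 c2.
Proof.
move=> cv; apply: lag_mono2 => u; rewrite ffunE; case: eqP => [->|_].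
  have h : J * D2 <= c2 v - deg G2 v by move: cv; clear; lia.
  have := leq_mul (leqnn D1) h; rewrite /C; lia.
by rewrite mulnDr; lia.
Qed.

Lemma lag_add1 c1 c2 v : lag (add_chip c1 v) c2 <= lag c1 c2 + D2.
Proof.
rewrite /lag (bigD1 v) //= [X in _ <= X + _](bigD1 v) //= addnAC; apply: leq_add.
  by rewrite ffunE eqxx mulnDr muln1; lia.
by apply: leq_sum => u /negbTE uv; rewrite ffunE uv addn0.
Qed.

Lemma lag_add2 c1 c2 v : lag c1 (add_chip c2 v) <= lag c1 c2.
Proof. by apply: lag_mono2 => u; rewrite ffunE mulnDr; lia. Qed.

Lemma heavy_card c D : J * D * #|[set v | J * D <= c v]%SET| <= chips c.
Proof.
rewrite mulnC -sum_nat_const /chips big_mkcond /=; apply: leq_sum => v _.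
by rewrite inE; case: ifP.
Qed.

(** If no chip lowers the lag by [D1], each vertex of height at most [J] contributes less than [D1].
    A taller one adds at most [2 * D1 * D2] more by semi-stability, and the number of chips limits
    how many are tall. *)
Lemma lag_reduce2 c1 c2 : (forall v, c1 v < J * D1 + deg G1 v) ->
  (exists w, lag c1 (add_chip c2 w) + D1 <= lag c1 c2) \/
  J * lag c1 c2 <= J * (n * D1) + 2 * D2 * chips c1.
Proof.
move=> c1b; have [/existsP [w /andP[w1 w2]]|/existsPn no] :=
  boolP [exists w, (minn (D1 * c2 w) C + D1 <= D2 * c1 w) && (D1 * c2 w + D1 <= C)].
  left; exists w; rewrite /lag (bigD1 w) //= [X in _ <= X](bigD1 w) //= addnAC.
  apply: leq_add; first by rewrite ffunE eqxx mulnDr muln1; lia.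
  by apply: leq_sum => u /negbTE uw; rewrite ffunE uw addn0.
right; have := heavy_card c1 D1; set h := #|_|.
have lagh : lag c1 c2 <= n * D1 + 2 * D1 * D2 * h.
  have -> : n * D1 = \sum_(v : V) D1 by rewrite sum_nat_const.
  rewrite [_ * h]mulnC -sum_nat_const [X in _ <= _ + X]big_mkcond -big_split /=.
  apply: leq_sum => v _; rewrite inE.
  have := no v; rewrite negb_and -!ltnNge => /orP hv; case: ifP => cv; last first.
    have {}cv : D2 * c1 v <= C.
      have {}cv : c1 v <= J * D1 by rewrite ltnW // ltnNge cv.
      by have := leq_mul (leqnn D2) cv; rewrite /C; lia.
    by case: hv; lia.
  have h1 : D2 * c1 v <= C + 2 * D1 * D2.
    have := leq_mul (leqnn D2) (leq_trans (ltnW (c1b v)) (leq_add (leqnn _) (deg1 v))).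
    by rewrite /C; lia.
  by case: hv; lia.
move=> hc; apply: leq_trans (leq_mul (leqnn J) lagh) _.
by have := leq_mul (leqnn (2 * D2)) hc; rewrite mulnDr; lia.
Qed.

(** A chip is free where the first board is lower by at least one chip. If there is no such vertex,
    the second board is nowhere much higher, apart from heights above the cap; when the totals are
    in step it cannot be much lower overall either, so the lag is small. *)
Lemma lag_keep1 c1 c2 : (forall v, c2 v < J * D2 + deg G2 v) ->
  (exists w, lag (add_chip c1 w) c2 <= lag c1 c2) \/
  J * (lag c1 c2 + D1 * chips c2) <= J * (D2 * chips c1 + n * D2) + 2 * D1 * chips c2.
Proof.
move=> c2b; have [/existsP [w hw]|/existsPn no] :=
  boolP [exists w, D2 * c1 w + D2 <= minn (D1 * c2 w) C].
  left; exists w; apply: leq_sum => u _; rewrite ffunE mulnDr.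
  by case: eqP => [->|_]; lia.
right; have := heavy_card c2 D2; set h := #|_|.
have lagh : lag c1 c2 + D1 * chips c2 <= D2 * chips c1 + n * D2 + 2 * D1 * D2 * h.
  have -> : n * D2 = \sum_(v : V) D2 by rewrite sum_nat_const.
  rewrite [_ * h]mulnC -sum_nat_const [X in _ <= _ + X]big_mkcond /lag /chips !big_distrr /=.
  rewrite -!big_split /=; apply: leq_sum => v _; rewrite inE.
  have := no v; rewrite -ltnNge => hv; case: ifP => cv; last first.
    have {}cv : D1 * c2 v <= C.
      have {}cv : c2 v <= J * D2 by rewrite ltnW // ltnNge cv.
      by have := leq_mul (leqnn D1) cv; rewrite /C; lia.
    by lia.
  have h1 : D1 * c2 v <= C + 2 * D1 * D2.
    have := leq_mul (leqnn D1) (leq_trans (ltnW (c2b v)) (leq_add (leqnn _) (deg2 v))).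
    by rewrite /C; lia.
  by lia.
move=> hc; apply: leq_trans (leq_mul (leqnn J) lagh) _.
by have := leq_mul (leqnn (2 * D1)) hc; rewrite !mulnDr; lia.
Qed.

(** [kappa] dominates the bounds of [lag_reduce2] and [lag_keep1] as long as the first board has at
    most [2 * n * D1] chips. [T2] is the rescaled length of the first game plus room for putting [e]
    chips on every vertex. *)
Variables (kappa T T2 e : nat).
Hypothesis T_small : T <= 2 * n * D1.
Hypothesis kappa_big : J * ((n + 5) * (D1 + D2)) + 4 * n * D1 * D2 + 2 * D1 <= J * kappa.
Hypothesis T2_big : T * D2 + D1 + (2 * (n * e) + 1) * D1 <= T2 * D1.
Hypothesis final : forall c1 c2, volatile G1 c1 ->
  (forall v, c1 v <= (J + 3) * D1) -> (forall v, c2 v <= (J + 2) * D2) ->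
  lag c1 c2 <= kappa + 2 * (D1 + D2) -> volatile G2 [ffun v => c2 v + e].

(* [r1], [r2] are the configurations actually played, [c1], [c2] semi-stabilised
   versions of them.  In [bal_lag] the halves count Min's moves: such a move raises
   the lag by at most [D2] on the first board, and lowers it by [D1] on the second
   one unless the lag is already small. *)
Record balanced r1 r2 c1 c2 : Prop := Balanced {
  bal_reach1 : reach G1 r1 c1;
  bal_reach2 : reach G2 r2 c2;
  bal_bound1 : forall v, c1 v < J * D1 + deg G1 v;
  bal_bound2 : forall v, c2 v < J * D2 + deg G2 v;
  bal_lag : lag c1 c2 + D1 * (chips r2)./2 <= kappa + D2 * (chips r1)./2;
  bal_sync1 : chips r1 * D2 <= chips r2 * D1 + D2;
  bal_sync2 : chips r2 * D1 <= chips r1 * D2 + D1 }.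

Let final_ends r2 c1 c2 k b : volatile G1 c1 -> reach G2 r2 c2 ->
  (forall v, c1 v <= (J + 3) * D1) -> (forall v, c2 v < J * D2 + deg G2 v) ->
  lag c1 c2 <= kappa + 2 * (D1 + D2) -> 2 * (n * e) < k -> ends_within G2 k b r2.
Proof.
move=> vol re b1 b2 hlag hk; apply: (@ends_fill _ _ (n * e) _ _ _ (fun=> e)) => //.
  by rewrite sum_nat_const.
have := @reach_volatileD _ G2 r2 c2 [ffun=> e] re.
have -> : [ffun v => c2 v + [ffun=> e] v] = [ffun v => c2 v + e] by apply/ffunP => v; rewrite !ffunE.
have -> : [ffun v => r2 v + [ffun=> e] v] = [ffun v => r2 v + e] by apply/ffunP => v; rewrite !ffunE.
apply; apply: (final vol) => // v; have := b2 v; have := deg2 v; lia.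
Qed.

(** The board that is behind in rescaled time moves. Min on the first board follows the given
    strategy and Max on the second one is arbitrary; the other two players move by [lag_keep1] and
    [lag_reduce2]. When these find no useful vertex, the lag is so small that any vertex will do. *)
Lemma simulate N k1 k2 r1 r2 c1 c2 : k1 + k2 <= N -> balanced r1 r2 c1 c2 ->
  chips r1 + k1 = T -> chips r2 + k2 = T2 ->
  ends_within G1 k1 (~~ odd (chips r1)) r1 -> ends_within G2 k2 (~~ odd (chips r2)) r2.
Proof.
elim: N k1 k2 r1 r2 c1 c2 => [|N IH] k1 k2 r1 r2 c1 c2 kN bal m1 m2 ends1.
  have := T2_big; have := bal_sync2 bal; move: m1 m2; move: kN; rewrite leqn0 addn_eq0.
  by move=> /andP[/eqP -> /eqP ->]; rewrite !addn0 => -> ->; move: D1_gt0; clear; nia.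
case: (bal) => re1 re2 b1 b2 hlag sync1 sync2.
(* The clocks differ by at most one chip, so the moves reserved for the final filling are never
   consumed. *)
have room : 2 * (n * e) < k2.
  have : (chips r2 + (2 * (n * e) + 1)) * D1 <= (chips r2 + k2) * D1.
    rewrite m2; apply: leq_trans T2_big; rewrite mulnDl leq_add2r.
    apply: leq_trans sync2 _; rewrite leq_add2r leq_mul2r -m1 leq_addr orbT //.
  by rewrite leq_pmul2r //; clear; lia.
have lagb : lag c1 c2 <= kappa + D1 + D2.
  by move: hlag sync1; clear; nia.
have [vol1|nvol1] := EM (volatile G1 r1).
  apply: (final_ends _ (reach_volatile re1 vol1) re2 _ b2 _ room).
    by move=> v; have := b1 v; have := deg1 v; lia.
  by move: lagb; clear; lia.
have [vol2|nvol2] := EM (volatile G2 r2); first exact: ends_volatile.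
case: k1 kN m1 ends1 => [|k1] kN m1; first by case.
case: k2 room kN m2 => [//|k2] room kN m2.
move=> [//|ends1].
have cr1 := reach_chips re1; have cr2 := reach_chips re2.
have /card_gt0P [v0 _] := V_gt0.
have m1T : chips r1 <= 2 * n * D1 by apply: leq_trans T_small; rewrite -m1 leq_addr.
have [sync|sync] := leqP (chips r1 * D2) (chips r2 * D1).
  have [v [ends1' lag']] : exists v, ends_within G1 k1 (~~ odd (chips r1).+1) (add_chip r1 v) /\
      lag (add_chip c1 v) c2 + D1 * (chips r2)./2 <= kappa + D2 * (chips r1).+1./2.
    have -> : odd (chips r1).+1 = ~~ odd (chips r1) by [].
    case oddm: (odd (chips r1)); rewrite oddm /= in ends1.
      case: ends1 => v h; exists v; split=> //; move: (lag_add1 c1 c2 v) hlag oddm; clear.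
      move: (lag _ _) (lag _ _) => x y; nia.
    have [[w hw]|hb] := lag_keep1 c1 b2.
      exists w; split; first exact: ends1.
      apply: leq_trans (leq_trans hlag _); first by rewrite leq_add2r.
      by rewrite leq_add2l leq_mul2l half_leq ?orbT.
    exists v0; split; first exact: ends1.
    rewrite -(leq_pmul2l J_gt0); have a1 := leq_mul (leqnn J) (lag_add1 c1 c2 v0).
    have a2 : 2 * (chips r2)./2 <= chips r2 by clear; lia.
    have a3 : chips r1 = 2 * (chips r1).+1./2 by move: oddm; clear; lia.
    have {}a2 := leq_mul (leqnn (J * D1)) a2.
    have a4 := leq_mul (leqnn J) sync1.
    have a5 := leq_mul m1T (leqnn D2).
    move: hb kappa_big a1 a2 a4 a5 sync2; rewrite cr1 cr2 -/n; move: (lag _ _) (lag _ _) a3; clear.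
    by move: (chips r1) ((chips r1).+1./2) ((chips r2)./2) (chips r2) => x y z t a b ->; lia.
  have re1' := reach_add_chip v re1; set c1' := add_chip c1 v in lag' re1'.
  have b1' u : c1' u <= J * D1 + deg G1 u.
    by rewrite ffunE; have := b1 u; case: eqP => _; lia.
  have [vol1|nvol1'] := EM (volatile G1 c1').
    apply: (final_ends _ vol1 re2 _ b2 _ room).
      by move=> u; have := b1' u; have := deg1 u; lia.
    by apply: leq_trans (lag_add1 _ _ _) _; move: lagb; clear; lia.
  have [f u hf cu|c1'' [re1'' lag'' b1'']] := @semistabilize _ G1 (J * D1)
      (fun f => lag f c2 + D1 * (chips r2)./2 <= kappa + D2 * (chips r1).+1./2) c1' _ lag' nvol1'.
    by apply: leq_trans hf; rewrite leq_add2r; apply: lag_fire1.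
  apply: (IH k1 k2.+1 (add_chip r1 v) r2 c1'' c2) => //; rewrite ?chips_add.
  - split=> //; rewrite ?chips_add //.
    + exact: reach_trans re1' re1''.
    + by rewrite mulSn; move: sync; clear; lia.
    + by rewrite mulSn; move: sync2; clear; lia.
  - by move: m1; clear; lia.
  - exact: ends1'.
have next2 v : lag c1 (add_chip c2 v) + D1 * (chips r2).+1./2 <= kappa + D2 * (chips r1)./2 ->
    ends_within G2 k2 (~~ odd (chips r2).+1) (add_chip r2 v).
  move=> lag'; have re2' := reach_add_chip v re2; set c2' := add_chip c2 v in lag' re2'.
  have [vol2|nvol2'] := EM (volatile G2 c2').
    apply: ends_volatile; apply: contrapT => nv.
    have := reach_volatileD (f := [ffun=> 0]) re2'.
    have -> : [ffun v => c2' v + [ffun=> 0] v] = c2' by apply/ffunP => u; rewrite !ffunE addn0.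
    move=> /(_ vol2) h; apply: nv; apply: volatile_mono h => u; rewrite !ffunE; lia.
  have [f u hf cu|c2'' [re2'' lag'' b2'']] := @semistabilize _ G2 (J * D2)
      (fun f => lag c1 f + D1 * (chips r2).+1./2 <= kappa + D2 * (chips r1)./2) c2' _ lag' nvol2'.
    by apply: leq_trans hf; rewrite leq_add2r; apply: lag_fire2.
  rewrite -(chips_add r2 v); apply: (IH k1.+1 k2 r1 (add_chip r2 v) c1 c2'') => //; rewrite ?chips_add.
  - by move: kN; clear; lia.
  - split=> //; rewrite ?chips_add //.
    + exact: reach_trans re2' re2''.
    + by rewrite mulSn; move: sync1; clear; lia.
    + by rewrite mulSn; move: sync; clear; lia.
  - by move: m2; clear; lia.
  - by right.
have oE : odd (chips r2).+1 = ~~ odd (chips r2) by [].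
right; case oddm: (odd (chips r2)); move: next2; rewrite oE oddm => next2.
  have [[w hw]|hb] := lag_reduce2 c2 b1.
    exists w; apply: next2; apply: leq_trans hlag.
    have -> : (chips r2).+1./2 = (chips r2)./2 + 1 by move: oddm; clear; lia.
    by move: hw; rewrite mulnDr muln1; clear; lia.
  exists v0; apply: next2; rewrite -(leq_pmul2l J_gt0).
  have a1 := leq_mul (leqnn J) (lag_add2 c1 c2 v0).
  have a2 : 2 * (chips r2).+1./2 <= (chips r2).+1 by clear; lia.
  have a3 : chips r1 <= 2 * (chips r1)./2 + 1 by clear; lia.
  have {}a2 := leq_mul (leqnn (J * D1)) a2.
  have {}a3 := leq_mul (leqnn (J * D2)) a3.
  have a4 := leq_mul (leqnn J) sync2.
  have a5 := leq_mul m1T (leqnn D2).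
  move: hb kappa_big a1 a2 a3 a4 a5; rewrite cr1 -/n; move: (lag _ _) (lag _ _); clear.
  by move: (chips r1) ((chips r1)./2) ((chips r2).+1./2) (chips r2) => x y z t a b; lia.
move=> v; apply: next2; apply: leq_trans hlag.
apply: leq_add (lag_add2 _ _ _) _; rewrite leq_mul2l; apply/orP; right.
by move: oddm; clear; lia.
Qed.

Lemma transfer : ends_within G1 T true (no_chips V) -> ends_within G2 T2 true (no_chips V).
Proof.
have c0 : chips (no_chips V) = 0 by rewrite /chips big1 // => v _; rewrite ffunE.
have := @simulate (T + T2) T T2 (no_chips V) (no_chips V) (no_chips V) (no_chips V).
rewrite c0 !add0n => /= h; apply: h => //; split; rewrite ?c0 //.
- exact: reach_refl.
- exact: reach_refl.
- by move=> v; rewrite ffunE addn_gt0 muln_gt0 J_gt0 D1_gt0.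
- by move=> v; rewrite ffunE addn_gt0 muln_gt0 J_gt0 D2_gt0.
- by rewrite /lag big1 ?muln0 // => v _; rewrite ffunE muln0.
Qed.

End Simulation.

(** * Comparing toppling numbers *)

Lemma ends_within_many (V : finType) (G : sgraph V) (v0 : V) k b c :
  (\sum_v deg G v < chips c + k + #|V|)%N -> ends_within G k b c.
Proof.
elim: k b c => [|k IH] b c h; first by left; apply: volatile_many; rewrite addn0 in h.
by right; case: b => [v|]; last exists v0; apply: IH; rewrite chips_add addSnnS.
Qed.

Lemma chips0 (V : finType) : chips (no_chips V) = 0%N.
Proof. by rewrite /chips big1 // => v _; rewrite ffunE. Qed.

(** More chips than the sum of the degrees force volatility. The bound provides [T_small], which
    limits the number of tall vertices in the simulation. *)
Lemma toppling_number_small (V : finType) (G : sgraph V) (D : nat) : (0 < #|V|)%N ->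
  (forall v, deg G v <= 2 * D)%N -> (toppling_number G <= 2 * #|V| * D)%N.
Proof.
move=> V0 degD; have /card_gt0P [v0 _] := V0.
have h : (\sum_v deg G v <= 2 * #|V| * D)%N.
  by rewrite mulnAC mulnC -sum_nat_const; apply: leq_sum.
apply: leq_trans (@toppling_number_le _ _ (\sum_v deg G v) _) h.
by apply: (ends_within_many v0); rewrite chips0 add0n /= -[X in (X < _)%N]addn0 ltn_add2l.
Qed.

Section Compare.
Local Open Scope ring_scope.
Variables (R : realType) (V : finType) (G1 G2 : sgraph V) (D1 D2 : nat) (delta : R) (M : nat).
Hypotheses (gd1 : good G1 D1 delta M) (gd2 : good G2 D2 delta M).
Variables (l J W : nat) (eps : R).
Let n := #|V|.
Hypothesis HlW : (J + 7 + l + 3 <= W)%N.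
Hypothesis V7 : (7 <= #|V|)%N.
Hypothesis Vl : (#|V| < 2 ^ l)%N.
Hypothesis eps01 : 0 < eps <= 1.
Hypothesis delta0 : 0 <= delta.
Hypothesis deltaW : 32 * W%:R ^+ 3 * delta <= eps.
Hypothesis WM : 8 * W%:R ^+ 2 <= eps * M%:R.
Hypothesis WdM : W%:R <= delta * M%:R.
Hypothesis Jbig : 48 <= eps ^+ 2 * J%:R.
Hypothesis D1big : 32 <= eps ^+ 2 * D1%:R.
Hypothesis D2big : 32 <= eps ^+ 2 * D2%:R.

Let e2_le : eps ^+ 2 <= eps.
Proof. by have /andP[e0 e1] := eps01; rewrite expr2 ler_piMr // ltW. Qed.

Let D_gt0 D : 32 <= eps ^+ 2 * D%:R -> (0 < D)%N.
Proof. by case: D => // h; exfalso; move: h; rewrite mulr0; lra. Qed.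

Let D32 D : 32 <= eps ^+ 2 * D%:R -> 32 <= eps * D%:R.
Proof. by move=> h; have := ler_wpM2r (ler0n R D) e2_le; lra. Qed.

(** Of the added height [4 * eps], a part [3 * eps] shifts [s] and the rest covers lags
    [y v <= eps]. A vertex with a larger lag loses at most [2 / eps * y v], so all of them lose at
    most [eps * n]; the criterion goes from [s + 2 * eps] to [s + eps]. *)
Lemma volatile_transfer (c1 c2 : {ffun V -> nat}) (e : nat) : volatile G1 c1 ->
  (forall v, c1 v <= (J + 3) * D1)%N -> (forall v, c2 v <= (J + 2) * D2)%N ->
  (lag D1 D2 J c1 c2)%:R <= eps ^+ 2 / 2 * n%:R * (D1%:R * D2%:R) ->
  4 * eps * D2%:R <= e%:R -> (e <= 5 * D2)%N ->
  volatile G2 [ffun v => c2 v + e]%N.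
Proof.
move=> vol c1b c2b hlag he1 he2.
have /andP[e0 e1] := eps01.
have V0 : (0 < #|V|)%N by apply: leq_trans V7.
have VR0 : 0 < n%:R :> R by rewrite ltr0n.
have D1R : 0 < D1%:R :> R by rewrite ltr0n; apply: D_gt0.
have D2R : 0 < D2%:R :> R by rewrite ltr0n; apply: D_gt0.
have DD : 0 < D1%:R * D2%:R :> R by rewrite mulr_gt0.
have H1 (s : R) : (s - eps) * n%:R <= (\sum_v Num.truncn ((c1 v)%:R / D1%:R + s))%N%:R.
  rewrite leNgt; apply/negP => def.
  apply: (@deficit_nonvolatile R V G1 D1 delta M gd1 l (J + 7) W eps _ _ _ _ _ _ _ _ _ c1 s _ def vol) => //.
    exact: D_gt0.
  by move=> v; apply: leq_trans (c1b v) _; rewrite leq_mul2r leq_add2l orbT.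
(* The height [J + 7] is [J + 2] for [c2] plus at most 5 for the added [e]. *)
apply: (@robust_volatile R V G2 D2 delta M gd2 l (J + 7) W eps) => //.
- exact: D_gt0.
- move=> v; rewrite ffunE; have := c2b v; move: he2; clear; lia.
move=> s; pose y v := (D2 * c1 v - minn (D1 * c2 v) (J * D1 * D2))%N%:R / (D1%:R * D2%:R) : R.
have y0 v : 0 <= y v by rewrite divr_ge0 // ltW.
have ylag : \sum_v y v <= eps ^+ 2 / 2 * n%:R.
  by rewrite -mulr_suml -natr_sum ler_pdivrMr.
have xy v : (c1 v)%:R / D1%:R <= (c2 v)%:R / D2%:R + y v.
  rewrite -(ler_pM2r DD) mulrDl /y divfK ?gt_eqF //.
  have -> : (c1 v)%:R / D1%:R * (D1%:R * D2%:R) = (D2 * c1 v)%N%:R :> R.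
    by rewrite mulrA divfK ?gt_eqF // natrM mulrC.
  have -> : (c2 v)%:R / D2%:R * (D1%:R * D2%:R) = (D1 * c2 v)%N%:R :> R.
    by rewrite [D1%:R * _]mulrC mulrA divfK ?gt_eqF // natrM mulrC.
  by rewrite -natrD ler_nat; clear; lia.
have pt v : (Num.truncn ((c1 v)%:R / D1%:R + (s + 3 * eps)))%:R - 2 / eps * y v
    <= (Num.truncn (([ffun v => (c2 v + e)%N] v)%:R / D2%:R + s))%:R :> R.
  set w' := _ + s; set w := _ + (s + _).
  have ww : w - y v + eps <= w'.
    rewrite /w /w' ffunE natrD mulrDl.
    have : 4 * eps <= e%:R / D2%:R by rewrite ler_pdivlMr.
    have := xy v; lra.
  have ye : 0 <= 2 / eps * y v by rewrite mulr_ge0 // divr_ge0 // ltW.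
  have [yv|yv] := leP (y v) eps.
    have : (Num.truncn w <= Num.truncn w')%N by apply: le_truncn; lra.
    by rewrite -(ler_nat R); lra.
  have : w' < (Num.truncn w')%:R + 1 by rewrite natr1 truncnS_gt.
  have : 2 * y v <= 2 / eps * y v.
    by rewrite -!mulrA ler_wpM2l // ler_peMl // invf_ge1.
  have : 2 < 2 / eps * y v by rewrite mulrAC ltr_pdivlMr //; lra.
  have [w0|w0] := leP 0 w.
    by have /andP[h _] := truncn_itv w0; lra.
  have -> : Num.truncn w = 0%N by apply/truncn0Pn; rewrite -ltNge; lra.
  by have := ler0n R (Num.truncn w'); lra.
have := H1 (s + 3 * eps).
have : (\sum_v Num.truncn ((c1 v)%:R / D1%:R + (s + 3 * eps)))%N%:R - 2 / eps * \sum_v y v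
   <= (\sum_v Num.truncn (([ffun v => (c2 v + e)%N] v)%:R / D2%:R + s))%N%:R :> R.
  by rewrite !natr_sum mulr_sumr -sumrB; apply: ler_sum => v _; apply: pt.
have : 2 / eps * \sum_v y v <= eps * n%:R.
  apply: le_trans (ler_wpM2l _ ylag) _; first by rewrite divr_ge0 // ltW.
  by rewrite le_eqVlt; apply/orP; left; apply/eqP; field; rewrite gt_eqF.
lra.
Qed.

(** The final filling takes [2 * n * e] moves, about [8 * eps * n * D2]; the roundings fit into the
    ninth [eps]. *)
Lemma toppling_compare :
  (toppling_number G2 * D1)%N%:R <=
  (toppling_number G1 * D2)%N%:R + 9 * eps * (n%:R * D1%:R * D2%:R) :> R.
Proof.
have /andP[e0 e1] := eps01.
have V0 : (0 < #|V|)%N by apply: leq_trans V7.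
have D1_gt0 := D_gt0 D1big; have D2_gt0 := D_gt0 D2big.
have J_gt0 : (0 < J)%N by case: J Jbig => // h; exfalso; move: h; rewrite mulr0; lra.
have VR7 : 7 <= n%:R :> R by rewrite (ler_nat R 7).
have D1R1 : 1 <= D1%:R :> R by rewrite (ler_nat R 1).
have D2R1 : 1 <= D2%:R :> R by rewrite (ler_nat R 1).
have d1 : delta <= 1.
  have W1 : 1 <= W%:R :> R by rewrite (ler_nat R 1); move: HlW; clear; lia.
  have W31 : 1 <= W%:R ^+ 3 :> R by rewrite exprn_ege1.
  by have := ler_wpM2r delta0 W31; have := deltaW; have := delta0; lra.
have degb G D : good G D delta M -> forall v, (deg G v <= 2 * D)%N.
  move=> gd v; have /andP[_ h] := good_deg gd v.
  rewrite -(ler_nat R) natrM; apply: le_trans h _; apply: ler_wpM2r => //; lra.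
pose e := (Num.truncn (4 * eps * D2%:R)).+1.
have eD0 : 0 <= 4 * eps * D2%:R by rewrite mulr_ge0 // mulr_ge0 // ltW.
have he1 : 4 * eps * D2%:R <= e%:R by rewrite ltW // truncnS_gt.
have he2 : e%:R <= 4 * eps * D2%:R + 1.
  by rewrite /e -natr1 lerD2r truncn_le.
have he3 : (e <= 5 * D2)%N.
  rewrite -(ler_nat R) natrM; apply: le_trans he2 _.
  by have := ler_wpM2r (ler0n R D2) e1; lra.
(* The first summand is small against [eps ^+ 2 * n * D1 * D2] because [D1] and [D2] are large, the
   second one because [J] is. *)
pose kappa := ((n + 5) * (D1 + D2) + ((4 * n * D1 * D2 + 2 * D1) %/ J).+1)%N.
pose T := toppling_number G1.
pose T2 := (T * D2 %/ D1 + 3 + 2 * (n * e))%N.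
have kb : (J * ((n + 5) * (D1 + D2)) + 4 * n * D1 * D2 + 2 * D1 <= J * kappa)%N.
  by rewrite /kappa [in leqRHS]mulnDr -addnA leq_add2l [leqRHS]mulnC ltnW // ltn_ceil.
have T2b : (T * D2 + D1 + (2 * (n * e) + 1) * D1 <= T2 * D1)%N.
  have := ltn_ceil (T * D2) D1_gt0; rewrite /T2.
  by move: (T * D2 %/ D1)%N (T * D2)%N (n * e)%N; clear; lia.
have eD1 := D32 D1big; have eD2 := D32 D2big.
have final (c1 c2 : {ffun V -> nat}) : volatile G1 c1 -> (forall v, c1 v <= (J + 3) * D1)%N ->
    (forall v, c2 v <= (J + 2) * D2)%N -> (lag D1 D2 J c1 c2 <= kappa + 2 * (D1 + D2))%N ->
    volatile G2 [ffun v => c2 v + e]%N.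
  move=> vol b1 b2 hl; apply: (volatile_transfer vol b1 b2 _ he1 he3).
  have {}hl : (lag D1 D2 J c1 c2)%:R <= (kappa + 2 * (D1 + D2))%N%:R :> R by rewrite ler_nat.
  apply: le_trans hl _.
  have q : ((4 * n * D1 * D2 + 2 * D1) %/ J)%N%:R * 48
      <= eps ^+ 2 * (4 * (n%:R * D1%:R * D2%:R) + 2 * D1%:R) :> R.
    have := leq_divM (4 * n * D1 * D2 + 2 * D1) J; set a := (_ %/ J)%N.
    rewrite -(ler_nat R) natrM natrD !natrM => h.
    have := ler_wpM2l (ler0n R a) Jbig; have := ler_wpM2l (ltW (exprn_gt0 2 e0)) h.
    lra.
  have n0 := ler0n R n; have p2 := ltW (exprn_gt0 2 e0).
  have a1 : 32 * (n%:R * D2%:R) <= eps ^+ 2 * (n%:R * D1%:R * D2%:R).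
    by have := ler_wpM2r (mulr_ge0 n0 (ler0n R D2)) D1big; lra.
  have a2 : 32 * (n%:R * D1%:R) <= eps ^+ 2 * (n%:R * D1%:R * D2%:R).
    by have := ler_wpM2r (mulr_ge0 n0 (ler0n R D1)) D2big; lra.
  have b1' := ler_wpM2r (ler0n R D1) VR7; have b2' := ler_wpM2r (ler0n R D2) VR7.
  have ee : eps ^+ 2 * D1%:R <= D1%:R.
    by rewrite -[leRHS]mul1r ler_wpM2r //; have := e2_le; lra.
  rewrite /kappa !natrD !natrM !natrD -[_.+1%:R]natr1; lra.
have main := @transfer V G1 G2 D1 D2 J V0 D1_gt0 D2_gt0 J_gt0 (degb _ _ _ gd1) (degb _ _ _ gd2)
  kappa T T2 e (toppling_number_small V0 (degb _ _ _ gd1)) kb T2b final (@toppling_numberP V G1).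
have {}main := toppling_number_le main.
have h : (toppling_number G2 * D1 <= T * D2 + (3 + 2 * (n * e)) * D1)%N.
  apply: leq_trans (leq_mul main (leqnn D1)) _; rewrite /T2 -addnA mulnDl leq_add2r.
  exact: leq_divM.
have {}h : (toppling_number G2 * D1)%N%:R <= (T * D2 + (3 + 2 * (n * e)) * D1)%N%:R :> R.
  by rewrite ler_nat.
apply: le_trans h _; rewrite natrD lerD2l !natrM natrD natrM natrM.
have n0 := ler0n R n.
have c1 := ler_wpM2l (mulr_ge0 n0 (ler0n R D1)) he2.
have c2 := ler_wpM2l (mulr_ge0 n0 (ler0n R D1)) eD2.
have c3 := ler_wpM2r (ler0n R D1) VR7.
lra.
Qed.

End Compare.

(** * The complete graph: quasirandomness and a quadratic lower bound *)

Section Complete.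
Local Open Scope nat_scope.
Variable V : finType.
Let n := #|V|.
Let K := complete_graph V.

Lemma adj_complete u v : adj K u v = (u != v).
Proof. by rewrite /adj inE cards2; case: (u != v). Qed.

Lemma nbsum_complete (k : V -> nat) v : nbsum K k v + k v = \sum_u k u.
Proof.
rewrite [RHS](bigD1 v) //= addnC; congr (_ + _); apply: eq_bigl => u.
by rewrite adj_complete eq_sym.
Qed.

Lemma deg_complete v : deg K v + 1 = n.
Proof. by rewrite -nbsum1 nbsum_complete sum1_card. Qed.

(** With [D = n], both the degrees and [degin S v] miss their nominal values by at most one, for the
    vertex itself, and [delta * n] covers this without exceptions. *)
Lemma good_complete (R : realType) (delta : R) M : (0 < n) -> (1 <= delta * n%:R)%R ->
  good K n delta M.
Proof.
move=> n0 dn; have nR0 : (0 < n%:R :> R)%R by rewrite ltr0n.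
have e0 (S : {set V}) : (n%:R * #|S|%:R / n%:R = #|S|%:R :> R)%R.
  by rewrite mulrAC divff ?mul1r // gt_eqF.
have dE S v : degin K S v + (v \in S) = #|S|.
  rewrite /degin nbsum_complete -sum1_card [RHS]big_mkcond /=.
  by apply: eq_bigr => u _; case: (u \in S).
split=> [v|S|S].
- have : ((deg K v)%:R + 1 = n%:R :> R)%R by rewrite natr1 -addn1 deg_complete.
  by move=> h; apply/andP; split; lra.
- rewrite (_ : [set v | _]%SET = finset.set0) ?cards0 ?muln0 //.
  apply/setP => v; rewrite !inE e0; apply/negbTE; rewrite -leNgt.
  have : ((degin K S v)%:R <= #|S|%:R :> R)%R by rewrite ler_nat -(dE S v) leq_addr.
  by lra.
- rewrite (_ : [set v | _]%SET = finset.set0) ?cards0 ?muln0 //.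
  apply/setP => v; rewrite !inE e0; apply/negbTE; rewrite -leNgt.
  have : (#|S|%:R <= (degin K S v)%:R + 1 :> R)%R.
    by rewrite natr1 ler_nat -(dE S v) -addn1 leq_add2l; case: (v \in S).
  by lra.
Qed.

(** The stabilising vector rounds [c v / n] to a nearby integer. Every vertex receives at most the
    sum of this vector, which is at most [n / 2] because a vertex that fires holds nearly [n / 2]
    chips. *)
Lemma complete_nonvolatile (c : {ffun V -> nat}) : 5 <= n -> 6 * chips c <= n * n ->
  ~ volatile K c.
Proof.
move=> n5 few; have n0 : 0 < n by apply: leq_trans n5.
pose k v := (c v + n./2 + 1) %/ n.
have kc v : k v * n <= 3 * c v.
  rewrite /k; have [h|h] := ltnP (c v + n./2 + 1) n; first by rewrite divn_small.
  by apply: leq_trans (leq_divM _ _) _; move: h n5; clear; lia.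
have Kn : \sum_v k v <= n./2.
  have : (\sum_v k v) * n <= 3 * chips c.
    by rewrite big_distrl /chips big_distrr; apply: leq_sum => v _; apply: kc.
  by move: few n0; clear; nia.
apply: (@stab_nonvolatile _ _ _ k) => v.
have := nbsum_complete k v; have := deg_complete v; have := ltn_ceil (c v + n./2 + 1) n0.
by rewrite -/(k v); move: Kn; clear; nia.
Qed.

Lemma ends_within_chips (G : sgraph V) (v0 : V) k b c : ends_within G k b c ->
  exists2 c', volatile G c' & chips c' <= chips c + k.
Proof.
elim: k b c => [|k IH] b c /= [vol|h] //; try by exists c => //; rewrite leq_addr.
have [v [b' h']] : exists v, exists b', ends_within G k b' (add_chip c v).
  by case: b h => [h|[v h]]; [exists v0, false; apply: h | exists v, true].
by have [c' vol le] := IH _ _ h'; exists c' => //; rewrite chips_add addSnnS in le.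
Qed.

Lemma toppling_number_complete : 5 <= n -> n * n <= 6 * toppling_number K.
Proof.
move=> n5; have /card_gt0P [v0 _] : 0 < #|V| by apply: leq_trans n5.
have [c vol] := ends_within_chips v0 (@toppling_numberP V K).
rewrite chips0 add0n => le; rewrite leqNgt; apply/negP => lt.
by apply: (complete_nonvolatile n5 _ vol); apply: ltnW (leq_ltn_trans _ lt); rewrite leq_mul2l.
Qed.

End Complete.

(** * Chernoff bounds for the binomial random graph *)

Section Chernoff.
Local Open Scope ring_scope.
Variables (R : realType) (n : nat) (p : R).
Hypothesis p01 : 0 <= p <= 1.
Let p0 : 0 <= p. Proof. by case/andP: p01. Qed.
Let p1 : 0 <= 1 - p. Proof. by rewrite subr_ge0; case/andP: p01. Qed.

(** Independence of the edges, obtained by expanding the product over all families of sets; a family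
    containing a set that is not a pair contributes 0 through [F]. *)
Lemma Gnp_mgf (w : {set 'I_n} -> R) :
  \sum_(G : sgraph 'I_n) Gnp_pmf p G * \prod_(e in edges G) w e =
  \prod_(e : {set 'I_n} | #|e| == 2%N) (1 - p + p * w e).
Proof.
pose F (e : {set 'I_n}) := if #|e| == 2%N then p * w e else 0.
pose H (e : {set 'I_n}) : R := if #|e| == 2%N then 1 - p else 1.
pose f (J : {set {set 'I_n}}) := \prod_e (if e \in J then F e else H e).
have -> : \prod_(e : {set 'I_n} | #|e| == 2%N) (1 - p + p * w e) = \sum_J f J.
  have -> : \sum_J f J = \prod_e (F e + H e).
    by rewrite bigA_distr; apply: eq_bigl => J; rewrite inE.
  rewrite big_mkcond; apply: eq_bigr => e _.
  by rewrite /F /H; case: ifP => _; rewrite addrC ?addr0.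
rewrite (bigID (fun J : {set {set 'I_n}} => [forall e in J, #|e| == 2%N])) /= [X in _ = _ + X]big1 ?addr0.
  rewrite (reindex_onto (@edges 'I_n) (insubd (complete_graph 'I_n))); last first.
    by move=> J PJ; apply: (insubdK (complete_graph 'I_n)).
  apply: eq_big => [G|G _]; first by rewrite (edges_card2 G) (valKd (complete_graph 'I_n) G) eqxx.
  rewrite /Gnp_pmf /f big_mkcond [X in _ * X]big_mkcond -big_split /=.
  apply: eq_bigr => e _; rewrite /F /H; have [eG|eG] := boolP (e \in edges G).
    by have /forall_inP /(_ _ eG) -> := edges_card2 G.
  by rewrite mulr1.
move=> J; rewrite negb_forall => /existsP [e]; rewrite negb_imply => /andP[eJ /negbTE e2].
by apply/eqP; rewrite prodf_seq_eq0; apply/hasP; exists e; rewrite ?mem_index_enum // eJ /F e2 eqxx.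
Qed.

Lemma Gnp_pmf_ge0 (G : sgraph 'I_n) : 0 <= Gnp_pmf p G.
Proof. by apply: prodr_ge0 => e _; case: ifP. Qed.

Lemma Gnp_total : \sum_(G : sgraph 'I_n) Gnp_pmf p G = 1.
Proof.
have := Gnp_mgf (fun=> 1); rewrite [RHS]big1 => [<-|e _]; last by rewrite mulr1 subrK.
by apply: eq_bigr => G _; rewrite big1 ?mulr1.
Qed.

Lemma Gnp_probC (A : pred (sgraph 'I_n)) : Gnp_prob p A = 1 - Gnp_prob p (predC A).
Proof. by rewrite -Gnp_total (bigID A) /= /Gnp_prob addrK. Qed.

Lemma Gnp_prob_sub (A B : pred (sgraph 'I_n)) : (forall G, A G -> B G) ->
  Gnp_prob p A <= Gnp_prob p B.
Proof.
move=> AB; rewrite /Gnp_prob big_mkcond [leRHS]big_mkcond; apply: ler_sum => G _.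
by case: ifP => [/AB ->//|_]; case: ifP => // _; apply: Gnp_pmf_ge0.
Qed.

Lemma Gnp_prob_union (I : finType) (A : pred (sgraph 'I_n)) (B : I -> pred (sgraph 'I_n)) :
  (forall G, A G -> exists i, B i G) -> Gnp_prob p A <= \sum_i Gnp_prob p (B i).
Proof.
move=> AB; rewrite /Gnp_prob big_mkcond /=.
under [leRHS]eq_bigr do rewrite big_mkcond.
rewrite exchange_big /=; apply: ler_sum => G _; case: ifP => [/AB [i Bi]|_].
  rewrite (bigD1 i) //= Bi lerDl; apply: sumr_ge0 => j _.
  by case: ifP => // _; apply: Gnp_pmf_ge0.
by apply: sumr_ge0 => j _; case: ifP => // _; apply: Gnp_pmf_ge0.
Qed.

(** [expR x] is at most the inverse of [1 - x]. *)
Lemma expR_le_quad (x : R) : x <= 1 / 2 -> expR x <= 1 + x + 2 * x ^+ 2.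
Proof.
move=> x2; have := expR_ge1Dx (- x); rewrite expRN => h.
have x1 : 0 < 1 - x by lra.
apply: (@le_trans _ _ ((1 - x)^-1)).
  by rewrite -[leLHS]invrK lef_pV2 // posrE // invr_gt0 expR_gt0.
rewrite -[leLHS]mul1r ler_pdivrMr //.
have -> : (1 + x + 2 * x ^+ 2) * (1 - x) = 1 + x ^+ 2 * (1 - 2 * x) by ring.
by rewrite lerDl mulr_ge0 ?sqr_ge0 //; lra.
Qed.

(** The number of ordered pairs from [T] and [S] that span [e], equal to 2 for an edge inside both.
    It writes the total degree from [T] into [S] as a sum over independent edges. *)
Definition pair_weight (S T : {set 'I_n}) (e : {set 'I_n}) : nat :=
  \sum_(v in T) \sum_(u in S) ([set v; u]%SET == e).

Lemma sum_degin (G : sgraph 'I_n) (S T : {set 'I_n}) :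
  (\sum_(v in T) degin G S v = \sum_(e in edges G) pair_weight S T e)%N.
Proof.
rewrite /pair_weight exchange_big /=; apply: eq_bigr => v _.
rewrite exchange_big /= /degin /nbsum big_mkcond [RHS]big_mkcond /=; apply: eq_bigr => u _.
rewrite /adj; case: (u \in S); last by case: ifP.
have [h|h] := boolP ([set v; u]%SET \in edges G).
  by rewrite (bigD1 _ h) /= eqxx big1 // => e /andP[_ /negbTE]; rewrite eq_sym => ->.
by rewrite big1 // => e eG; case: eqP => // E; rewrite -E (negbTE h) in eG.
Qed.

Lemma pair_weight_le2 (S T e : {set 'I_n}) : #|e| = 2%N -> (pair_weight S T e <= 2)%N.
Proof.
move=> e2; rewrite -[leqRHS]e2 -sum1_card /pair_weight big_mkcond [leqRHS]big_mkcond /=.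
apply: leq_sum => v _; case: ifP => // _.
rewrite big_mkcond /=; have [ve|ve] := boolP (v \in e); last first.
  rewrite leqn0 big1 // => u _; case: ifP => // _; case: eqP => // E.
  by rewrite -E !inE eqxx in ve.
apply: (@leq_trans #|[set u | [set v; u]%SET == e]%SET|).
  by rewrite -sum1dep_card [leqRHS]big_mkcond; apply: leq_sum => u _; case: ifP => // _; case: eqP.
apply/card_le1_eqP => u u'; rewrite !inE => /eqP E /eqP E'.
have : u \in [set v; u']%SET by rewrite E' -E !inE eqxx orbT.
rewrite !inE => /orP[/eqP uv|/eqP //].
by move: e2; rewrite -E uv cards2 eqxx.
Qed.

Lemma pair_weight_sum (S T : {set 'I_n}) :
  let w := (\sum_(e : {set 'I_n} | #|e| == 2) pair_weight S T e)%N in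
  (w <= #|S| * #|T|)%N /\ (#|S| * #|T| <= w + #|T|)%N.
Proof.
have -> : (\sum_(e : {set 'I_n} | #|e| == 2) pair_weight S T e =
    \sum_(v in T) \sum_(u in S) (v != u))%N.
  rewrite /pair_weight exchange_big /=; apply: eq_bigr => v _.
  rewrite exchange_big /=; apply: eq_bigr => u _.
  have [->|vu] := eqVneq v u.
    rewrite big1 // => e e2; case: eqP => // E.
    by move: e2; rewrite -E cards2 eqxx.
  rewrite (bigD1 [set v; u]%SET) /=; last by rewrite cards2 vu.
  by rewrite eqxx big1 // => e /andP[_ /negbTE]; rewrite eq_sym => ->.
cbv zeta; rewrite mulnC -sum_nat_const; split.
  apply: leq_sum => v _; rewrite -sum1_card; apply: leq_sum => u _; exact: leq_b1.
rewrite -[X in (_ <= _ + X)%N]sum1_card -big_split /=; apply: leq_sum => v _.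
rewrite -sum1_card; have [vS|vS] := boolP (v \in S); last first.
  by apply: leq_trans (leq_addr _ _); apply: leq_sum => u uS; case: eqP => // E; rewrite E uS in vS.
rewrite (bigD1 v) //= [X in (_ <= X + _)%N](bigD1 v) //= eqxx add0n addnC leq_add2r.
by apply: leq_sum => u /andP[_ uv]; rewrite eq_sym uv.
Qed.

(** Weights are at most 2, so [th * W <= 1 / 2] as [expR_le_quad] requires, and [W ^+ 2 <= 2 * W]
    makes the quadratic term linear in the weight. *)
Lemma mgf_le (S T : {set 'I_n}) (th : R) : `|th| <= 1 / 4 ->
  \sum_(G : sgraph 'I_n) Gnp_pmf p G * expR (th * (\sum_(v in T) degin G S v)%N%:R) <=
  expR (p * (th + 4 * th ^+ 2) * (\sum_(e : {set 'I_n} | #|e| == 2) pair_weight S T e)%N%:R).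
Proof.
rewrite ler_norml => /andP[th1 th2].
pose w (e : {set 'I_n}) := expR (th * (pair_weight S T e)%:R).
have -> : \sum_(G : sgraph 'I_n) Gnp_pmf p G * expR (th * (\sum_(v in T) degin G S v)%N%:R)
   = \sum_(G : sgraph 'I_n) Gnp_pmf p G * \prod_(e in edges G) w e.
  apply: eq_bigr => G _; congr (_ * _); rewrite sum_degin natr_sum mulr_sumr.
  by rewrite expR_sum.
rewrite Gnp_mgf natr_sum mulr_sumr expR_sum; apply: ler_prod => e /eqP e2.
have wp : 0 <= w e by apply: expR_ge0.
apply/andP; split; first by rewrite addr_ge0 // mulr_ge0.
set W := (pair_weight S T e)%:R : R.
have W0 : 0 <= W by rewrite ler0n.
have W2 : W <= 2 by rewrite (ler_nat R _ 2) pair_weight_le2.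
have thW : th * W <= 1 / 2.
  apply: (@le_trans _ _ (1 / 4 * W)); last by lra.
  by apply: ler_wpM2r.
have we : w e <= 1 + th * W + 2 * (th * W) ^+ 2 by apply: expR_le_quad.
have sq : (th * W) ^+ 2 <= 2 * th ^+ 2 * W.
  have := ler_wpM2l (mulr_ge0 (sqr_ge0 th) W0) W2; lra.
apply: (@le_trans _ _ (1 + p * (th + 4 * th ^+ 2) * W)); last exact: expR_ge1Dx.
have : p * w e <= p * (1 + th * W + 2 * (2 * th ^+ 2 * W)).
  by apply: ler_wpM2l => //; lra.
lra.
Qed.

Lemma markov_exp (A : pred (sgraph 'I_n)) (f : sgraph 'I_n -> R) (b c : R) :
  (forall G, A G -> b <= f G) ->
  \sum_(G : sgraph 'I_n) Gnp_pmf p G * expR (f G) <= expR c ->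
  Gnp_prob p A <= expR (c - b).
Proof.
move=> Af h; rewrite expRB ler_pdivlMr ?expR_gt0 //; apply: le_trans h.
rewrite /Gnp_prob mulr_suml big_mkcond; apply: ler_sum => G _; case: ifP => [/Af bf|_].
  by apply: ler_wpM2l; [exact: Gnp_pmf_ge0 | rewrite ler_expR].
by rewrite mulr_ge0 ?Gnp_pmf_ge0 ?expR_ge0.
Qed.

Variable tau : R.
Hypotheses (pn0 : 0 < p * n%:R) (tau2 : 2 <= tau) (tau4 : tau <= 4 * (p * n%:R)).
Let q := expR (- (tau ^+ 2 / (64 * (p * n%:R)))).

(* The value minimising [4 * th ^+ 2 * (p * n) - th * tau / 2]. *)
Let th := tau / (16 * (p * n%:R)).
Let th_itv : 0 <= th <= 1 / 4.
Proof.
have h : 0 < 16 * (p * n%:R) by rewrite mulr_gt0.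
apply/andP; split; first by rewrite divr_ge0 // ?ltW //; have := tau2; lra.
by rewrite ler_pdivrMr //; have := tau4; lra.
Qed.

Let th_opt : 4 * th ^+ 2 * (p * n%:R) - th * tau / 2 = - (tau ^+ 2 / (64 * (p * n%:R))).
Proof. rewrite /th; move: (p * n%:R) pn0 => m m0; field; by rewrite gt_eqF. Qed.

(** The degrees of different vertices of [T] share edges, so the exponential bound is applied to
    their sum. The power [#|T|] is what survives a union bound over [T]. *)
Lemma chernoff_high (S T : {set 'I_n}) :
  Gnp_prob p (fun G => [forall v in T, p * #|S|%:R + tau <= (degin G S v)%:R]) <= q ^+ #|T|.
Proof.
have /andP[th0 th4] := th_itv.
have [w1 w2] := pair_weight_sum S T; set w := (\sum_(e | _) _)%N in w1 w2.
have Sn : #|S|%:R <= n%:R :> R by rewrite ler_nat (leq_trans (max_card _)) ?card_ord.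
have nth : `|th| <= 1 / 4 by rewrite ger0_norm.
apply: le_trans (@markov_exp _ _ (th * ((p * #|S|%:R + tau) * #|T|%:R)) _ _ (mgf_le S T nth)) _.
  move=> G /forall_inP h; apply: ler_wpM2l => //.
  rewrite natr_sum mulr_natr -sumr_const; apply: ler_sum => v vT; exact: h.
rewrite -/w /q -expRM_natl ler_expR -th_opt.
have w1R : w%:R <= #|S|%:R * #|T|%:R :> R by rewrite -natrM ler_nat.
have c0 : 0 <= p * (th + 4 * th ^+ 2) by rewrite mulr_ge0 // addr_ge0 // mulr_ge0 // sqr_ge0.
have h1 := ler_wpM2l c0 w1R.
have T0 := ler0n R #|T|.
have h2 : 4 * th ^+ 2 * p * #|T|%:R * #|S|%:R <= 4 * th ^+ 2 * p * #|T|%:R * n%:R.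
  by apply: ler_wpM2l Sn; exact: mulr_ge0 (mulr_ge0 (mulr_ge0 (ler0n R 4) (sqr_ge0 th)) p0) T0.
have tau0 : 0 <= tau by have := tau2; lra.
have h3 := mulr_ge0 (mulr_ge0 th0 tau0) T0.
lra.
Qed.

Lemma chernoff_low (S T : {set 'I_n}) :
  Gnp_prob p (fun G => [forall v in T, (degin G S v)%:R <= p * #|S|%:R - tau]) <= q ^+ #|T|.
Proof.
have /andP[th0 th4] := th_itv.
have [w1 w2] := pair_weight_sum S T; set w := (\sum_(e | _) _)%N in w1 w2.
have Sn : #|S|%:R <= n%:R :> R by rewrite ler_nat (leq_trans (max_card _)) ?card_ord.
have nth : `|- th| <= 1 / 4 by rewrite normrN ger0_norm.
apply: le_trans (@markov_exp _ _ (- th * ((p * #|S|%:R - tau) * #|T|%:R)) _ _ (mgf_le S T nth)) _.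
  move=> G /forall_inP h; rewrite !mulNr lerN2; apply: ler_wpM2l => //.
  rewrite natr_sum mulr_natr -sumr_const; apply: ler_sum => v vT; exact: h.
rewrite -/w /q -expRM_natl ler_expR -th_opt.
have w1R : w%:R <= #|S|%:R * #|T|%:R :> R by rewrite -natrM ler_nat.
have w2R : #|S|%:R * #|T|%:R <= w%:R + #|T|%:R :> R by rewrite -natrM -natrD ler_nat.
have T0 := ler0n R #|T|.
have c1 : 0 <= 4 * (p * th ^+ 2) by exact: mulr_ge0 (ler0n R 4) (mulr_ge0 p0 (sqr_ge0 th)).
have h1 := ler_wpM2l c1 w1R.
have h4 := ler_wpM2l (mulr_ge0 p0 th0) w2R.
have h2 : 4 * th ^+ 2 * p * #|T|%:R * #|S|%:R <= 4 * th ^+ 2 * p * #|T|%:R * n%:R.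
  by apply: ler_wpM2l Sn; exact: mulr_ge0 (mulr_ge0 (mulr_ge0 (ler0n R 4) (sqr_ge0 th)) p0) T0.
(* Diagonal pairs cost at most [p * th * #|T|], which [2 <= tau] keeps within half of
   [th * tau * #|T|]; hence the [tau / 2] in [th_opt]. *)
have h3 := ler_wpM2r (mulr_ge0 th0 T0) tau2.
have h5 : p * (th * #|T|%:R) <= 1 * (th * #|T|%:R).
  by apply: ler_wpM2r; [rewrite mulr_ge0 | have := p1; lra].
rewrite sqrrN; lra.
Qed.

End Chernoff.

(** * Probability that the random graph is quasirandom *)

Section GoodProb.
Local Open Scope ring_scope.
Variables (R : realType) (n : nat) (p : R).
Hypothesis p01 : 0 <= p <= 1.
Hypothesis n_gt0 : (0 < n)%N.

Let nR0 : 0 < n%:R :> R. Proof. by rewrite ltr0n. Qed.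
Let nR1 : 1 <= n%:R :> R. Proof. by rewrite (ler_nat R 1). Qed.

Lemma Gnp_prob_or (A B C : pred (sgraph 'I_n)) : (forall G, A G -> B G || C G) ->
  Gnp_prob p A <= Gnp_prob p B + Gnp_prob p C.
Proof.
move=> ABC; have := @Gnp_prob_union R n p p01 bool A (fun b => if b then B else C).
rewrite big_bool /=; apply => G /ABC /orP[]; by [exists true | exists false].
Qed.

Lemma sum_pow_card (I : finType) (x : R) : \sum_(S : {set I}) x ^+ #|S| = (1 + x) ^+ #|I|.
Proof.
have -> : (1 + x) ^+ #|I| = \prod_(i : I) (x + 1) by rewrite prodr_const addrC.
rewrite bigA_distr; apply: eq_big => [J|J _]; first by rewrite inE.
by rewrite -big_mkcond /= prodr_const.
Qed.

(** Each element of [T] accounts for a factor [n ^ M] in the choice of [S], a factor [n] in the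
    choice of [T], and a factor [q] in the probability. *)
Lemma union_pairs (B : {set 'I_n} -> {set 'I_n} -> pred (sgraph 'I_n)) (q : R) (M : nat) :
  0 <= q -> n%:R ^+ M.+1 * q <= 1 / 2 -> (forall S T, Gnp_prob p (B S T) <= q ^+ #|T|) ->
  Gnp_prob p (fun G => [exists S : {set 'I_n}, exists T : {set 'I_n},
    [&& (0 < #|T|)%N, (#|S| <= M * #|T|)%N & B S T G]])
  <= expR 1 * (2 * (n%:R ^+ M.+1 * q)).
Proof.
move=> q0 small HB.
pose C (i : {set 'I_n} * {set 'I_n}) (G : sgraph 'I_n) :=
  [&& (0 < #|i.2|)%N, (#|i.1| <= M * #|i.2|)%N & B i.1 i.2 G].
have := @Gnp_prob_union R n p p01 _ (fun G => [exists S : {set 'I_n}, exists T : {set 'I_n},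
    [&& (0 < #|T|)%N, (#|S| <= M * #|T|)%N & B S T G]]) C.
move=> /(_ _) /le_trans; apply.
  by move=> G /existsP [S /existsP [T h]]; exists (S, T).
(* The constraint [#|S| <= M * #|T|] is relaxed to the weight [n ^ (M * #|T| - #|S|)]. *)
pose y := n%:R ^+ M * q.
have y0 : 0 <= y by rewrite mulr_ge0 // exprn_ge0.
pose a (S : {set 'I_n}) : R := n%:R^-1 ^+ #|S|.
pose b (T : {set 'I_n}) : R := if (0 < #|T|)%N then y ^+ #|T| else 0.
apply: (@le_trans _ _ (\sum_(i : {set 'I_n} * {set 'I_n}) a i.1 * b i.2)).
  apply: ler_sum => -[S T] _; rewrite /C /= /a /b.
  have a0 : 0 <= n%:R^-1 ^+ #|S| :> R by rewrite exprn_ge0 // invr_ge0.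
  have [T0|T0] := ltnP 0 #|T|; last by rewrite /= /Gnp_prob big_pred0_eq mulr0.
  have [ST|ST] := leqP #|S| (M * #|T|); last first.
    by rewrite /= /Gnp_prob big_pred0_eq mulr_ge0 // exprn_ge0.
  rewrite /=; apply: le_trans (HB S T) _; rewrite /y exprMn mulrA -exprM.
  rewrite -[leLHS]mul1r; apply: ler_wpM2r; first by rewrite exprn_ge0.
  rewrite exprVn -(ler_pM2l (x := n%:R ^+ #|S|)) ?exprn_gt0 // mulr1 mulrA divff ?mul1r.
    by apply: ler_weXn2l.
  by rewrite expf_neq0 // gt_eqF.
rewrite -(pair_bigA _ (fun S T => a S * b T)) /= -big_distrlr /=.
have aE : \sum_S a S <= expR 1.
  rewrite /a sum_pow_card card_ord -[X in expR X](mulfV (x := n%:R)) ?gt_eqF // expRM_natl.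
  by apply: lerXn2r; rewrite ?nnegrE ?addr_ge0 ?invr_ge0 ?expR_ge0 // expR_ge1Dx.
have bE : \sum_T b T <= 2 * (n%:R ^+ M.+1 * q).
  have -> : \sum_T b T = (1 + y) ^+ n - 1.
    have := sum_pow_card 'I_n y; rewrite card_ord => <-.
    rewrite (bigD1 finset.set0) //= [in RHS](bigD1 finset.set0) //= cards0 expr0 /b cards0 ltnn add0r.
    rewrite addrAC subrr add0r; apply: eq_bigr => T T0.
    by rewrite card_gt0 T0.
  have e1 : (1 + y) ^+ n <= expR (n%:R * y).
    rewrite expRM_natl; apply: lerXn2r; rewrite ?nnegrE ?addr_ge0 ?expR_ge0 //.
    exact: expR_ge1Dx.
  have yE : n%:R * y = n%:R ^+ M.+1 * q by rewrite /y mulrA -exprS.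
  have := expR_le_quad (x := n%:R * y); rewrite yE => /(_ small) e2.
  rewrite yE in e1; have z0 : 0 <= n%:R ^+ M.+1 * q by rewrite mulr_ge0 // exprn_ge0.
  have := ler_wpM2l z0 small; lra.
apply: ler_pM => //; first by apply: sumr_ge0 => S _; rewrite exprn_ge0 // invr_ge0.
by apply: sumr_ge0 => T _; rewrite /b; case: ifP => // _; rewrite exprn_ge0.
Qed.

Lemma expR1_le4 : expR 1 <= 4 :> R.
Proof.
have := @expR_le_quad R (1 / 2) (lexx _); have := expR_gt0 (1 / 2 : R).
have -> : expR 1 = expR (1 / 2) ^+ 2 :> R by rewrite -expRM_natl; congr expR; lra.
move: (expR _) => x; nra.
Qed.

(** A failure of [good_high] or [good_low] yields a set [S] and an exceptional set [T] with
    [#|S| < M * #|T|]; a failure of [good_deg] is the case of the full [S] and a singleton [T]. Half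
    of [delta] goes into [tau], the other half covers the rounding of [p * n]. *)
Lemma Gnp_good (delta : R) (M : nat) : delta <= 1 -> 4 <= delta * (p * n%:R) ->
  let N := n%:R ^+ M.+1 * expR (- (delta ^+ 2 * (p * n%:R) / 256)) in
  N <= 1 / 2 ->
  1 - 18 * N <= Gnp_prob p (fun G : sgraph 'I_n => `[< good G (Num.truncn (p * n%:R)) delta M >]).
Proof.
move=> d1 d4 N N2.
have /andP[p0 p1] := p01.
have m0 : 0 <= p * n%:R by rewrite mulr_ge0.
have m1 : 0 < p * n%:R by rewrite lt_neqAle m0 andbT eq_sym; apply/eqP => E; move: d4; rewrite E mulr0; lra.
have d0 : 0 < delta by rewrite -(pmulr_lgt0 _ m1); lra.
have dm : delta * (p * n%:R) <= 1 * (p * n%:R) by rewrite ler_wpM2r.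
pose tau := delta * (p * n%:R) / 2.
pose q : R := expR (- (tau ^+ 2 / (64 * (p * n%:R)))).
have qE : q = expR (- (delta ^+ 2 * (p * n%:R) / 256)).
  rewrite /q /tau; congr (expR (- _)); move: (p * n%:R) m1 => m m1; field; by rewrite gt_eqF.
have tau2 : 2 <= tau by rewrite /tau; lra.
have tau4 : tau <= 4 * (p * n%:R) by rewrite /tau; lra.
have q0 : 0 <= q by apply: expR_ge0.
have NE : N = n%:R ^+ M.+1 * q by rewrite /N qE.
clearbody N; rewrite NE in N2.
have high := chernoff_high p01 m1 tau2 tau4; have low := chernoff_low p01 m1 tau2 tau4.
have bad1 := union_pairs q0 N2 high; have bad2 := union_pairs q0 N2 low.
set B1 := (fun G : sgraph 'I_n => _) in bad1; set B2 := (fun G : sgraph 'I_n => _) in bad2.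
have nq : n%:R * q <= N.
  rewrite NE; apply: ler_wpM2r => //; rewrite exprS -[leLHS]mulr1; apply: ler_wpM2l => //.
  exact: exprn_ege1.
pose B3 (G : sgraph 'I_n) := [exists v : 'I_n, [forall u in [set v]%SET,
   p * #|[set: 'I_n]%SET|%:R + tau <= (degin G [set: 'I_n]%SET u)%:R]].
pose B4 (G : sgraph 'I_n) := [exists v : 'I_n, [forall u in [set v]%SET,
   (degin G [set: 'I_n]%SET u)%:R <= p * #|[set: 'I_n]%SET|%:R - tau]].
have sumq : \sum_(v : 'I_n) q ^+ #|[set v]%SET| = n%:R * q.
  under eq_bigr do rewrite cards1 expr1.
  by rewrite sumr_const card_ord mulr_natl.
have bad3 : Gnp_prob p B3 <= n%:R * q.
  rewrite -sumq; apply: le_trans (Gnp_prob_union p01 _) (ler_sum _ (fun v _ => high [set: 'I_n]%SET [set v]%SET)).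
  by move=> G /existsP.
have bad4 : Gnp_prob p B4 <= n%:R * q.
  rewrite -sumq; apply: le_trans (Gnp_prob_union p01 _) (ler_sum _ (fun v _ => low [set: 'I_n]%SET [set v]%SET)).
  by move=> G /existsP.
rewrite Gnp_probC lerD2l lerN2.
have cover G : predC (fun G : sgraph 'I_n => `[< good G (Num.truncn (p * n%:R)) delta M >]) G ->
    (B1 G || B2 G) || (B3 G || B4 G).
  move=> /= ng; apply: contraNT ng; rewrite !negb_or => /andP[/andP[n1 n2] /andP[n3 n4]].
  apply/asboolP; set D := Num.truncn _.
  have /andP[D1 D2] : D%:R <= p * n%:R < D.+1%:R by apply: truncn_itv.
  rewrite -[D.+1%:R]natr1 in D2.
  have dD : delta * (p * n%:R) <= delta * (D%:R + 1) by rewrite ler_wpM2l // ltW.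
  have k1 (S : {set 'I_n}) : p * #|S|%:R + tau <= D%:R * #|S|%:R / n%:R + delta * D%:R.
    have Sn : #|S|%:R <= n%:R :> R by rewrite ler_nat (leq_trans (max_card _)) ?card_ord.
    have h : p * #|S|%:R * n%:R <= (D%:R * #|S|%:R / n%:R + 1) * n%:R.
      rewrite mulrDl divfK ?gt_eqF // mul1r.
      have := ler_wpM2r (ler0n R #|S|) (ltW D2); lra.
    rewrite ler_pM2r // in h; rewrite /tau; lra.
  have k2 (S : {set 'I_n}) : D%:R * #|S|%:R / n%:R - delta * D%:R <= p * #|S|%:R - tau.
    have h : D%:R * #|S|%:R / n%:R <= p * #|S|%:R.
      rewrite ler_pdivrMr //; have := ler_wpM2r (ler0n R #|S|) D1; lra.
    rewrite /tau; lra.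
  have degT G' v : degin G' [set: 'I_n]%SET v = deg G' v.
    by rewrite -nbsum1 /degin /nbsum; apply: eq_bigr => u _; rewrite inE.
  have nT : #|[set: 'I_n]%SET|%:R = n%:R :> R by rewrite cardsT card_ord.
  split=> [v|S|S].
  - have kk1 := k1 [set: 'I_n]%SET; have kk2 := k2 [set: 'I_n]%SET.
    rewrite nT mulfK ?gt_eqF // in kk1 kk2.
    apply/andP; split.
      rewrite leNgt; apply/negP => h; move/existsPn: n4 => /(_ v) /negP; apply.
      by apply/forall_inP => u /set1P ->; rewrite degT nT; lra.
    rewrite leNgt; apply/negP => h; move/existsPn: n3 => /(_ v) /negP; apply.
    by apply/forall_inP => u /set1P ->; rewrite degT nT; lra.
  - rewrite leqNgt card_ord; set T := [set v | _]%SET; apply/negP => h.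
    move/existsPn: n1 => /(_ S) /existsPn /(_ T) /negP; apply.
    apply/and3P; split; [by case: #|T| h => //; rewrite muln0 | exact: ltnW |].
    by apply/forall_inP => v; rewrite inE => hv; apply: le_trans (k1 S) (ltW hv).
  - rewrite leqNgt card_ord; set T := [set v | _]%SET; apply/negP => h.
    move/existsPn: n2 => /(_ S) /existsPn /(_ T) /negP; apply.
    apply/and3P; split; [by case: #|T| h => //; rewrite muln0 | exact: ltnW |].
    by apply/forall_inP => v; rewrite inE => hv; apply: le_trans (ltW hv) (k2 S).
have N0 : 0 <= N by rewrite NE mulr_ge0 // exprn_ge0.
(* With [expR 1 <= 4], [B1] and [B2] cost [8 * N] each, [B3] and [B4] at most [N] each: 18 in
   all. *)
have e4 := ler_wpM2r N0 expR1_le4.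
apply: le_trans (Gnp_prob_or cover) _.
have := @Gnp_prob_or (fun G => B1 G || B2 G) B1 B2 (fun G => id).
have := @Gnp_prob_or (fun G => B3 G || B4 G) B3 B4 (fun G => id).
rewrite -NE in bad1 bad2; lra.
Qed.

End GoodProb.

(** * Asymptotics *)

Section Asymptotics.
Local Open Scope ring_scope.
Variable R : realType.

(** The quadratic lower bound for the complete graph turns the additive [9 * eps] into a relative
    [54 * eps]; the rounding of [p * n] to [D] takes the rest of 55. *)
Lemma toppling_close (n : nat) (G : sgraph 'I_n) (p delta eps : R) (D M l J W : nat) :
  good G D delta M -> D%:R <= p * n%:R < D%:R + 1 -> (D <= n)%N ->
  (J + 7 + l + 3 <= W)%N -> (7 <= n)%N -> (n < 2 ^ l)%N -> 0 < eps <= 1 ->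
  1 <= delta * n%:R -> 32 * W%:R ^+ 3 * delta <= eps -> 8 * W%:R ^+ 2 <= eps * M%:R ->
  W%:R <= delta * M%:R -> 48 <= eps ^+ 2 * J%:R -> 32 <= eps ^+ 2 * D%:R ->
  let pt := p * (toppling_number (complete_graph 'I_n))%:R in
  0 < pt /\ `|(toppling_number G)%:R - pt| <= 55 * eps * pt.
Proof.
move=> gd /andP[Dm mD] Dn HW n7 nl e01 dn c1 c2 c3 c4 c5 pt.
have /andP[e0 e1] := e01.
have n0 : (0 < n)%N by apply: leq_trans n7.
have nR : 0 < n%:R :> R by rewrite ltr0n.
have d0 : 0 <= delta by rewrite ltW // -(pmulr_lgt0 _ nR) (lt_le_trans _ dn).
have nbig : 32 <= eps ^+ 2 * n%:R.
  by apply: le_trans c5 _; apply: ler_wpM2l; rewrite ?sqr_ge0 // ler_nat.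
have gK : good (complete_graph 'I_n) n delta M.
  by have := @good_complete 'I_n R delta M; rewrite card_ord; apply.
have n7' : (7 <= #|'I_n|)%N by rewrite card_ord.
have nl' : (#|'I_n| < 2 ^ l)%N by rewrite card_ord.
have up := @toppling_compare R _ _ _ _ _ _ _ gK gd l J W eps HW n7' nl' e01 d0 c1 c2 c3 c4 nbig c5.
have lo := @toppling_compare R _ _ _ _ _ _ _ gd gK l J W eps HW n7' nl' e01 d0 c1 c2 c3 c4 c5 nbig.
have tK := @toppling_number_complete 'I_n; rewrite card_ord in tK up lo.
move: up lo tK @pt; move: (toppling_number G) (toppling_number (complete_graph 'I_n)) => t k up lo tK pt.
have {}tK : n%:R * n%:R <= 6 * k%:R :> R.
  by rewrite -natrM -[6 * _]natrM ler_nat; apply: tK; apply: leq_trans n7.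
rewrite !natrM in up lo.
have k0 : 0 < k%:R :> R by have := mulr_gt0 nR nR; lra.
have D32 : 32 <= eps * D%:R.
  apply: le_trans c5 _; apply: ler_wpM2r => //.
  by rewrite expr2 ler_piMr // ltW.
have D0 : 0 < D%:R :> R.
  rewrite lt_neqAle ler0n andbT eq_sym; apply/eqP => E; move: D32; rewrite E mulr0; lra.
have pn0 : 0 < p * n%:R by apply: lt_le_trans Dm.
have p0 : 0 < p by rewrite -(pmulr_lgt0 _ nR).
split; first by rewrite mulr_gt0.
have eD : 0 <= eps * D%:R by rewrite mulr_ge0 // ltW.
have a1 := ler_wpM2l eD tK.
have a2 := ler_wpM2r (ltW k0) Dm.
have a3 := ler_wpM2r (ltW k0) (ltW mD).
have a4 := ler_wpM2l (ltW e0) a2.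
have a5 := ler_wpM2r (ltW k0) D32.
have ek := mulr_gt0 e0 k0.
rewrite ler_norml; apply/andP; split; rewrite -(ler_pM2r nR) /pt; lra.
Qed.

Lemma expR_dominates k : exists2 c : R, 0 < c & forall r, 0 <= r -> r ^+ k.+1 <= c * expR r.
Proof.
exists (k.+1)`!%:R; first by rewrite ltr0n fact_gt0.
move=> r r0; have f0 : 0 < (k.+1)`!%:R :> R by rewrite ltr0n fact_gt0.
rewrite mulrC -ler_pdivrMr //; apply: le_trans (expR_ge1Dxn k r0); by rewrite lerDr.
Qed.

Lemma ln2_ge : 1 / 2 <= ln 2 :> R.
Proof.
have h : expR (1 / 2) <= 2 :> R by have := @expR_le_quad R (1 / 2) (lexx _); lra.
by rewrite -[leLHS]expRK ler_ln // posrE ?expR_gt0.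
Qed.

Definition logsize (n : nat) : nat := (trunc_log 2 n).+1.

Lemma logsize_large L n : (2 ^ L <= n)%N -> (L < logsize n)%N.
Proof. by move=> h; rewrite /logsize ltnS; apply: trunc_log_max. Qed.

Lemma ltn_logsize n : (n < 2 ^ logsize n)%N.
Proof. exact: trunc_log_ltn. Qed.

(** The right-hand side is the exponential of [2 * sqrt (ln n)], and [ln n] is at least a quarter of
    [logsize n]. *)
Lemma expR_sqrt_logsize n : (2 <= logsize n)%N ->
  expR (Num.sqrt (logsize n)%:R) <= n%:R `^ (2 / Num.sqrt (ln n%:R)) :> R.
Proof.
rewrite {1}/logsize ltnS => l1.
have n0 : (0 < n)%N by case: n l1; rewrite ?trunc_log0.
have nR : 0 < n%:R :> R by rewrite ltr0n.
have l2 : 1 <= (trunc_log 2 n)%:R :> R by rewrite (ler_nat R 1).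
have lnn : (logsize n)%:R / 4 <= ln n%:R :> R.
  have h : (2 ^ trunc_log 2 n <= n)%N by apply: trunc_logP.
  have {}h : 2 ^+ trunc_log 2 n <= n%:R :> R by rewrite -natrX ler_nat.
  have : ln (2 ^+ trunc_log 2 n) <= ln n%:R :> R by rewrite ler_ln // posrE exprn_gt0.
  rewrite lnXn // -[ln 2 *+ _]mulr_natr; apply: le_trans.
  have := ler_wpM2r (ler0n R (trunc_log 2 n)) ln2_ge; rewrite /logsize -[(trunc_log 2 n).+1%:R]natr1; lra.
have lg0 : 0 < (logsize n)%:R :> R by rewrite ltr0n.
have ln0 : 0 < ln n%:R :> R by lra.
rewrite /powR gt_eqF // ler_expR.
have -> : 2 / Num.sqrt (ln n%:R) * ln n%:R = 2 * Num.sqrt (ln n%:R) :> R.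
  rewrite -[X in _ * X = _](sqr_sqrtr (ltW ln0)) expr2 mulrA divfK //.
  by rewrite gt_eqF // sqrtr_gt0.
have -> : 2 * Num.sqrt (ln n%:R) = Num.sqrt (4 * ln n%:R) :> R.
  rewrite sqrtrM // (_ : 4 = 2 ^+ 2); last by ring.
  by rewrite sqrtr_sqr ger0_norm.
by apply: ler_wsqrtr; lra.
Qed.

(** * Parameters as powers of the logarithm *)

Section Density.
Variable p : nat -> R.
Hypothesis p01 : forall n, 0 <= p n <= 1.
Hypothesis p_large : exists N, forall n, (N <= n)%N ->
  n%:R `^ (2 / Num.sqrt (ln n%:R)) <= p n * n%:R.

(** With [l = logsize n], [delta = l ^ -4] and [M = l ^ 6], this makes the Chernoff exponent
    [delta ^ 2 * p * n / 256] at least [3 * l ^ 7], against [n ^ M.+1 <= expR (2 * l ^ 7)]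
    choices. *)
Lemma density_polylog : exists N, forall n, (N <= n)%N ->
  768 * (logsize n)%:R ^+ 15 <= p n * n%:R.
Proof.
(* The 32nd power of [sqrt l] is [l ^ 16]; its spare factor [l] beats the constant [768 * c]. *)
have [N HN] := p_large; have [c c0 Hc] := expR_dominates 31.
pose L := (Num.truncn (768 * c)).+1.
exists (maxn N (2 ^ L.+1)) => n; rewrite geq_max => /andP[nN nL].
have lL := logsize_large nL.
apply: le_trans (HN n nN).
apply: le_trans (expR_sqrt_logsize _); last by move: lL; clear; lia.
have r0 : 0 <= Num.sqrt (logsize n)%:R :> R by rewrite sqrtr_ge0.
have h := Hc _ r0.
rewrite (_ : 32 = 2 * 16)%N // exprM sqr_sqrtr // in h.
rewrite -(ler_pM2l c0); apply: le_trans h.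
have lc : 768 * c <= (logsize n)%:R.
  have : 768 * c < L%:R by rewrite truncnS_gt.
  have : L%:R <= (logsize n)%:R :> R by rewrite ler_nat; move: lL; clear; lia.
  lra.
rewrite [leRHS]exprS mulrA [c * _]mulrC; apply: (ler_wpM2r _ lc); exact: exprn_ge0.
Qed.

(** As [W] is of order [logsize n], the fourth power makes [W ^ 3 * delta] small and the sixth one
    makes [delta * M] exceed [W]. *)
Definition logM n : nat := (logsize n ^ 6)%N.
Definition logdelta n : R := ((logsize n)%:R ^+ 4)^-1.
Definition typical n (G : sgraph 'I_n) : bool :=
  `[< good G (Num.truncn (p n * n%:R)) (logdelta n) (logM n) >].

Lemma typical_close (eps : R) : 0 < eps <= 1 -> exists N, forall n, (N <= n)%N ->
  forall G : sgraph 'I_n, typical G ->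
  let pt := p n * (toppling_number (complete_graph 'I_n))%:R in
  0 < pt /\ `|(toppling_number G)%:R - pt| <= 55 * eps * pt.
Proof.
move=> e01; have /andP[e0 e1] := e01; have [N HN] := density_polylog.
have e2 : 0 < eps ^+ 2 by rewrite exprn_gt0.
(* [J] depends on [eps] only, so [W = J + l + 10] is at most [2 * l] for large [n]. *)
pose J := (Num.truncn (48 / eps ^+ 2)).+1.
pose L := (J + 10 + (Num.truncn (256 / eps)).+1)%N.
exists (maxn N (2 ^ L)) => n; rewrite geq_max => /andP[nN nL] G /asboolP gd.
have lL := logsize_large nL; have dens := HN n nN; have nl := ltn_logsize n.
set l := logsize n in lL dens nl.
have lR1 : 11 <= l%:R :> R by rewrite (ler_nat R 11); move: lL; rewrite /L; clear; lia.
have l0 : 0 < l%:R :> R by lra.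
have lJ : J%:R + 10 <= l%:R :> R.
  by rewrite -natrD ler_nat; move: lL; rewrite /L; clear; lia.
have Je : 48 <= eps ^+ 2 * J%:R.
  have : 48 / eps ^+ 2 < J%:R by rewrite truncnS_gt.
  by rewrite ltr_pdivrMr // mulrC => /ltW.
have le : 256 <= eps * l%:R.
  have : 256 / eps < (Num.truncn (256 / eps)).+1%:R by rewrite truncnS_gt.
  have : (Num.truncn (256 / eps)).+1%:R <= l%:R :> R.
    by rewrite ler_nat; move: lL; rewrite /L; clear; lia.
  move=> a b; have : 256 / eps < l%:R by apply: lt_le_trans b a.
  by rewrite ltr_pdivrMr // mulrC => /ltW.
have pow i j : (i <= j)%N -> l%:R ^+ i <= l%:R ^+ j :> R.
  by move=> ij; apply: ler_weXn2l => //; lra.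
have mu0 : 0 <= p n * n%:R by have /andP[p0 _] := p01 n; rewrite mulr_ge0.
have mn : p n * n%:R <= n%:R by have /andP[_ p1] := p01 n; rewrite ler_piMl.
have /andP[D1 D2] := truncn_itv mu0; rewrite -[_.+1%:R]natr1 in D2.
have l15 := pow 1%N 15%N isT; have l4 := pow 4%N 15%N isT; rewrite expr1 in l15.
have delE : logdelta n * l%:R ^+ 4 = 1.
  by rewrite /logdelta mulVf // gt_eqF // exprn_gt0.
have del0 : 0 <= logdelta n by rewrite invr_ge0 exprn_ge0.
have l15' : 0 < l%:R ^+ 15 :> R by rewrite exprn_gt0.
have WR : (J + 7 + l + 3)%N%:R <= 2 * l%:R :> R by rewrite !natrD; lra.
apply: (@toppling_close n G (p n) (logdelta n) eps _ (logM n) l J (J + 7 + l + 3)%N gd) => //.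
- by rewrite D1 D2.
- by rewrite -(ler_nat R); apply: le_trans D1 mn.
- by rewrite -(ler_nat R); lra.
- by rewrite -[leLHS]delE; apply: ler_wpM2l => //; lra.
- have W3 : (J + 7 + l + 3)%N%:R ^+ 3 <= (2 * l%:R) ^+ 3 :> R.
    by apply: lerXn2r; rewrite ?nnegrE ?mulr_ge0.
  have h := ler_wpM2r del0 W3.
  have del3 : logdelta n * l%:R ^+ 3 * 256 <= eps.
    rewrite -[leRHS]mulr1 -[X in _ <= _ * X]delE.
    have := ler_wpM2l (mulr_ge0 del0 (exprn_ge0 3 (ltW l0))) le; lra.
  lra.
- have W2 : (J + 7 + l + 3)%N%:R ^+ 2 <= (2 * l%:R) ^+ 2 :> R.
    by apply: lerXn2r; rewrite ?nnegrE ?mulr_ge0.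
  rewrite /logM natrX -/l.
  have l2 := pow 2%N 5%N isT.
  have l5 := exprn_ge0 5 (ltW l0).
  have := ler_wpM2r l5 le; lra.
- rewrite /logM natrX -/l; apply: le_trans WR _.
  have -> : logdelta n * l%:R ^+ 6 = l%:R ^+ 2.
    by rewrite (_ : 6 = 4 + 2)%N // exprD mulrA delE mul1r.
  have := ler_wpM2r (ltW l0) lR1; lra.
- have le2 : 32 <= eps ^+ 2 * (l%:R * l%:R).
    have := ler_pM (ler0n R 256) (ler0n R 256) le le; lra.
  have l2 := pow 2%N 15%N isT.
  apply: le_trans le2 _; apply: ler_wpM2l; first exact: ltW.
  lra.
Qed.

Lemma typical_aas (eps : R) : 0 < eps -> exists N, forall n, (N <= n)%N ->
  1 - eps <= Gnp_prob (p n) (@typical n).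
Proof.
move=> e0; have [N HN] := density_polylog.
pose L := (Num.truncn (18 / eps)).+1.
exists (maxn N (2 ^ L)) => n; rewrite geq_max => /andP[nN nL].
have lL := logsize_large nL; have dens := HN n nN; have nl := ltn_logsize n.
have n0 : (0 < n)%N by apply: leq_trans nL; rewrite expn_gt0.
set l := logsize n in lL dens nl.
have lR1 : 2 <= l%:R :> R by rewrite (ler_nat R 2); move: lL; rewrite /L; clear; lia.
have l0 : 0 < l%:R :> R by lra.
have pow i j : (i <= j)%N -> l%:R ^+ i <= l%:R ^+ j :> R.
  by move=> ij; apply: ler_weXn2l => //; lra.
have delE i : logdelta n * l%:R ^+ (4 + i) = l%:R ^+ i.
  by rewrite exprD mulrA /logdelta mulVf ?mul1r // gt_eqF // exprn_gt0.
have del0 : 0 <= logdelta n by rewrite invr_ge0 exprn_ge0.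
have l1i i : 1 <= l%:R ^+ i :> R by apply: exprn_ege1; lra.
have del1 : logdelta n <= 1 by rewrite /logdelta invf_le1 ?exprn_gt0.
have dp : 768 * l%:R ^+ 11 <= logdelta n * (p n * n%:R).
  by have := ler_wpM2l del0 dens; rewrite mulrCA (delE 11%N).
have dp2 : 768 * l%:R ^+ 7 <= logdelta n ^+ 2 * (p n * n%:R).
  have := ler_wpM2l del0 dp; have E := delE 7%N.
  rewrite mulrCA E; lra.
have := @Gnp_good R n (p n) (p01 n) n0 (logdelta n) (logM n) del1.
set q := n%:R ^+ _ * _ => HG.
have qs : q <= expR (- l%:R).
  apply: (@le_trans _ _ (expR (2 * l%:R ^+ 7) * expR (- (3 * l%:R ^+ 7)))).
    apply: ler_pM; rewrite ?exprn_ge0 ?expR_ge0 //; last by rewrite ler_expR lerN2; lra.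
    have nE : n%:R <= expR l%:R :> R.
      apply: (@le_trans _ _ (2 ^+ l)); first by rewrite -natrX ler_nat ltnW.
      rewrite -[l%:R]mulr1 expRM_natl; apply: lerXn2r; rewrite ?nnegrE ?expR_ge0 //.
      by have := expR_ge1Dx (1 : R); lra.
    apply: (@le_trans _ _ (expR l%:R ^+ (logM n).+1)).
      by apply: lerXn2r; rewrite ?nnegrE ?expR_ge0.
    rewrite -expRM_natl ler_expR -natr1 /logM natrX -/l.
    have := pow 1%N 7%N isT; rewrite expr1; lra.
  rewrite -expRD ler_expR; have := pow 1%N 7%N isT; rewrite expr1; lra.
have qe : expR (- l%:R) * (1 + l%:R) <= 1 :> R.
  rewrite expRN mulrC ler_pdivrMr ?expR_gt0 // mul1r; exact: expR_ge1Dx.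
have q2 : q <= 1 / 2.
  have := expR_ge0 (- l%:R : R); have := ler_wpM2l (expR_ge0 (- l%:R : R)) lR1; lra.
have ql : 18 * q <= eps.
  have : 18 / eps < L%:R by rewrite truncnS_gt.
  rewrite ltr_pdivrMr // => h1.
  have h2 : L%:R <= l%:R :> R by rewrite ler_nat; move: lL; clear; lia.
  have h3 := ler_wpM2r (ltW e0) h2.
  have x0 := expR_ge0 (- l%:R : R).
  have h4 : 18 <= (1 + l%:R) * eps by lra.
  have h5 := ler_wpM2l x0 h4.
  have h6 := ler_wpM2r (ltW e0) qe.
  lra.
have : 1 - 18 * q <= Gnp_prob (p n) (@typical n).
  by apply: HG => //; have := l1i 11%N; lra.
lra.
Qed.

End Density.
End Asymptotics.

Local Open Scope ring_scope.
Local Open Scope classical_set_scope.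

Theorem theorem1p2 (R : realType) (p : nat -> R)
    (p01 : forall n, 0 <= p n <= 1)
    (p_large : \forall n \near \oo,
      n%:R `^ (2 / Num.sqrt (ln n%:R)) <= p n * n%:R) :
  exists eps : nat -> R, eps @ \oo --> (0 : R) /\
    Gnp_aas p (fun n G =>
      let pt := p n * (toppling_number (complete_graph 'I_n))%:R in
      `|(toppling_number G)%:R - pt| <= eps n * pt).
Proof.
have {}p_large : exists N, forall n, (N <= n)%N ->
    n%:R `^ (2 / Num.sqrt (ln n%:R)) <= p n * n%:R.
  by case: p_large => N _ HN; exists N => n nN; apply: HN.
pose pt n := p n * (toppling_number (complete_graph 'I_n))%:R.
pose err n (G : sgraph 'I_n) := `|(toppling_number G)%:R - pt n| / pt n.
(* One error sequence has to serve all accuracies: it is the largest relative error over typical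
   graphs, and 0 if there are none. *)
exists (fun n => \big[Num.max/0]_(G : sgraph 'I_n | typical p G) err n G); split.
  apply/cvgrPdist_le => e e0.
  pose e' := Num.min 1 (e / 55).
  have e'01 : 0 < e' <= 1.
    by rewrite /e' lt_min ltr01 divr_gt0 //= ge_min lexx.
  have e'e : 55 * e' <= e.
    by rewrite mulrC -ler_pdivlMr // /e' ge_min lexx orbT.
  have [N HN] := typical_close p01 p_large e'01.
  exists N => // n /= nN; rewrite sub0r normrN ger0_norm; last by apply: bigmax_ge_id.
  apply: bigmax_le; first exact: ltW.
  move=> G tG; have [pt0 h] := HN n nN G tG.
  by rewrite /err ler_pdivrMr //; apply: le_trans h _; apply: ler_wpM2r => //; apply: ltW.
apply/cvgrPdist_le => e e0.
have [N1 H1] := typical_aas p01 p_large e0.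
(* Used with [eps := 1] for the positivity of [pt], which allows division by it. *)
have [N2 H2] := typical_close p01 p_large (eps := 1) (ltac:(lra)).
exists (maxn N1 N2) => // n /=; rewrite geq_max => /andP[nN1 nN2].
set A := (fun G : sgraph 'I_n => _).
have sub : Gnp_prob (p n) (@typical _ p n) <= Gnp_prob (p n) A.
  apply: (Gnp_prob_sub (p01 n)) => G tG; have [pt0 _] := H2 n nN2 G tG.
  rewrite /A -ler_pdivrMr //; exact: (le_bigmax_cond _ (err n)).
have le1 : Gnp_prob (p n) A <= 1.
  rewrite (Gnp_probC (p n)) gerBl /Gnp_prob; apply: sumr_ge0 => G _.
  exact: Gnp_pmf_ge0 (p01 n) G.
by rewrite ger0_norm ?subr_ge0 //; have := H1 n nN1; lra.
Qed.
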